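(* Let $\mathsf{H}$ be a Euclidean space with Borel $\sigma$-algebra $\mathcal{B}$, let $(\Omega,\mathcal{F},\mathsf{P})$ be a complete probability space, let $(\mathsf{K},\mathcal{K})$ be a measurable space, and let $k\colon(\Omega,\mathcal{F},\mathsf{P})\to(\mathsf{K},\mathcal{K})$ be a random variable. Let $C$ be a nonempty closed convex subset of $\mathsf{H}$ and, for every $\kappa\in\mathsf{K}$, let $Z_\kappa$ be a nonempty closed convex subset of $\mathsf{H}$. Assume that the mapping $$T\colon(\mathsf{K}\times\mathsf{H},\mathcal{K}\otimes\mathcal{B})\to\mathbb{R}\colon(\kappa,\mathsf{x})\mapsto d_{Z_\kappa}^2(\mathsf{x})$$ is measurable, that $\mathsf{E}\,T(k,0)<+\infty$, and that $\operatorname{Argmin}\mathsf{E}\,T(k,\cdot)\neq\varnothing$. Denote by $\mathsf{Z}$ the set of solutions to the problem $$\underset{\mathsf{x}\in C}{\text{minimize}}\ \int_\Omega\tfrac12 d_{Z_{k(\omega)}}^2(\mathsf{x})\,\mathsf{P}(d\omega).$$ Let $x_0\in L^2(\Omega,\mathcal{F},\mathsf{P};\mathsf{H})$ and let $(\gamma_n)_{n\in\mathbb{N}}$ be a sequence in $(0,+\infty)$ such that $\sum_{n\in\mathbb{N}}\gamma_n=+\infty$ and $\sum_{n\in\mathbb{N}}\gamma_n^2<+\infty$. Iterate $$(\forall n\in\mathbb{N})\quad x_{n+1}=\operatorname{proj}_C\bigl((1-\gamma_n)x_n+\gamma_n\operatorname{proj}_{Z_{k_n}}(x_n)\bigr),$$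 where, for every $n\in\mathbb{N}$, $k_n$ is a copy of $k$ and is independent of $\sigma(x_0,\ldots,x_n)$. Then $(x_n)_{n\in\mathbb{N}}$ converges $\mathsf{P}$-a.s. and in $L^1(\Omega,\mathcal{F},\mathsf{P};\mathsf{H})$ to a $\mathsf{Z}$-valued random variable.
   Context: For a nonempty closed convex set $D\subset\mathsf{H}$, $d_D(\mathsf{x})=\inf_{\mathsf{y}\in D}\|\mathsf{x}-\mathsf{y}\|$ is the distance function and $\operatorname{proj}_D$ is the projection operator onto $D$. $\operatorname{Argmin}\mathsf{E}\,T(k,\cdot)$ is the set of minimizers over $\mathsf{H}$ of $\mathsf{x}\mapsto\mathsf{E}\,T(k,\mathsf{x})$, where $\mathsf{E}$ denotes expectation. A random variable $y$ is a copy of $x$ if $x$ and $y$ have the same distribution. For $p\in[1,+\infty)$, $L^p(\Omega,\mathcal{F},\mathsf{P};\mathsf{H})$ is the space of (classes of a.s. equal) $\mathsf{H}$-valued random variables $x$ with $\mathsf{E}\|x\|^p<+\infty$, with norm $(\mathsf{E}\|x\|^p)^{1/p}$. $\sigma(x_0,\ldots,x_n)$ is the $\sigma$-algebra generated by $x_0,\ldots,x_n$.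
   Formalization: The formal theorem additionally assumes that the solution set Z of the problem over C is nonempty; this does not follow from Argmin E T(k,·) ≠ ∅ (take C = {t ≤ 0}, Z_κ = {s > 0, st ≥ 1} in R²), and without it the claim is false. *)

(* Defs.v *)
From HB Require Import structures.
From mathcomp Require Import all_boot all_order all_algebra.
From mathcomp Require Import all_classical all_reals all_analysis.
Set Implicit Arguments.
Unset Strict Implicit.
Unset Printing Implicit Defensive.
Import Order.TTheory GRing.Theory Num.Theory.
Import numFieldNormedType.Exports.

Local Open Scope classical_set_scope.
Local Open Scope ring_scope.

(* The Euclidean space H is 'rV[R]_N with the standard inner product. The norm
   that the library puts on matrices is the sup norm, hence [enorm]; the two
   norms induce the same topology, so the library's [open], [closed] and
   [-->] on 'rV[R]_N are the Euclidean ones. *)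
Definition enorm (R : realType) (N : nat) (x : 'rV[R]_N) : R :=
  Num.sqrt (\sum_(i < N) x ord0 i ^+ 2).

Notation borelRV R N := (g_sigma_algebraType (@open 'rV[R]_N)).

Definition dist_set (R : realType) (N : nat) (D : set 'rV[R]_N) (x : 'rV[R]_N) : R :=
  inf [set enorm (x - y) | y in D].

(* The default value 0 is never used when D is nonempty, closed and convex:
   the set below is then a singleton. *)
Definition proj_set (R : realType) (N : nat) (D : set 'rV[R]_N) (x : 'rV[R]_N) :
    'rV[R]_N :=
  xget 0 [set p | D p /\ enorm (x - p) = dist_set D x].

Definition argmin (R : realType) (T : Type) (C : set T) (f : T -> \bar R) :
    set T :=
  [set x | C x /\ forall y, C y -> (f x <= f y)%E].

Definition nonempty_closed_convex (R : realType) (N : nat)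
    (D : set 'rV[R]_N) : Prop :=
  [/\ D !=set0, closed D & convex_set (D : set (convex_lmodType 'rV[R]_N))].

Section probability.
Context (d : measure_display) (Omega : measurableType d) (R : realType).
Variable P : probability Omega R.

(* The distributions are
   compared on measurable sets only, since a measure takes junk values on the
   other ones. *)
Definition is_copy (d' : measure_display) (K : measurableType d')
    (X Y : {RV P >-> K}) : Prop :=
  forall A : set K, measurable A -> distribution P X A = distribution P Y A.

Definition independent_of (d' : measure_display) (K : measurableType d')
    (X : {RV P >-> K}) (G : set (set Omega)) : Prop :=
  forall (A : set K) (B : set Omega), measurable A -> G B ->
    P (X @^-1` A `&` B) = (P (X @^-1` A) * P B)%E.

Variable N : nat.
Implicit Types x y : Omega -> 'rV[R]_N.

Definition random_vector x : Prop :=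
  measurable_fun [set: Omega] (x : Omega -> borelRV R N).

Definition sigma_upto (x : nat -> Omega -> 'rV[R]_N) (n : nat) :
    set (set Omega) :=
  g_sigma_preimage (fun i : 'I_n.+1 => (x i : Omega -> borelRV R N)).

Definition in_Lp (p : R) x : Prop :=
  random_vector x /\ ('N[P]_p%:E[(fun w => (enorm (x w))%:E)] < +oo)%E.

Definition cvg_Lp (p : R) (x : nat -> Omega -> 'rV[R]_N) y : Prop :=
  [/\ forall n, in_Lp p (x n), in_Lp p y &
    ('N[P]_p%:E[(fun w => (enorm (x n w - y w))%:E)] @[n --> \oo] --> 0)%E].

Section problem.
Context (d' : measure_display) (K : measurableType d').

Definition Tfun (Z : K -> set 'rV[R]_N) (kappa : K) (x : 'rV[R]_N) : R :=
  dist_set (Z kappa) x ^+ 2.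

(* The set of solutions to: minimize E (1/2) d_{Z_k}^2 over C. The existence of
   a minimizer over the whole space does not entail that this set is nonempty:
   in R^2 take Z_kappa = {(s, t) | 0 < s, 1 <= s t} for every kappa and
   C = {(s, t) | t <= 0}; the infimum over C is 0 and it is not attained. *)
Definition solutions (k : {RV P >-> K}) (Z : K -> set 'rV[R]_N)
    (C : set 'rV[R]_N) : set 'rV[R]_N :=
  argmin C (fun z : 'rV[R]_N =>
    \int[P]_w (2^-1 * dist_set (Z (k w)) z ^+ 2)%:E)%E.

End problem.
End probability.

(* Main.v *)
Require Import Defs.
From HB Require Import structures.
From mathcomp Require Import all_boot all_order all_algebra.
From mathcomp Require Import all_classical all_reals all_analysis.
From mathcomp Require Import measurable_realfun.
From mathcomp Require Import ring lra.
Set Implicit Arguments.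
Unset Strict Implicit.
Unset Printing Implicit Defensive.
Import Order.TTheory GRing.Theory Num.Theory.
Import numFieldNormedType.Exports.
Local Open Scope classical_set_scope.
Local Open Scope ring_scope.

(** Write [T kappa u] for the squared distance from [u] to [Z kappa], [f u] for
    the mean of [T (k w) u], [S] for the set of minimizers of [f] over [C], and
    [m] for the minimum.

    Since [u - proj_set (Z kappa) u] is half the gradient of the convex function
    [T kappa], the iteration is a projected stochastic gradient method for
    [f / 2]. Expanding the square, using the subgradient inequality and
    [T kappa (x n) <= 2 T kappa z + 2 |x n - z|^2], one gets for [z] in [C]
      |x (n+1) - z|^2 + g T(x n) <= (1 + 2 g^2) |x n - z|^2 + (g + 2 g^2) T(z)
    with [g = gamma n] and [T] taken at the index of step [n]
    ([relaxed_projection_le]). That index is independent of the past, so it may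
    be integrated out on any event of the past and for any [z] that depends on
    the past only ([integral_fresh], [integral_step]).

    If [z] takes its values in [S] then [T(z)] averages to the constant [m],
    whatever [z] is. Hence the second moments stay bounded and the sum of
    [gamma n * (E f (x n) - m)] is finite, so that [E f (x n)] comes arbitrarily
    close to [m] at arbitrarily late times ([mean_f_small]). By compactness, at
    such a time [j] the iterate is close to [S] with high probability
    ([late_near_solutions]). Now take [z] to be the projection of [x j] onto
    [S]: the squared distance from [x n] to [z] starts small and is, up to a small
    tail of the sum of [gamma n ^+ 2], a nonnegative supermartingale. The
    maximal inequality for such processes ([maximal_inequality]) shows that the
    whole tail of the sequence stays near [z] with high probability
    ([tail_near_solution]). Therefore the sequence is almost surely Cauchy with
    limit in [S]; no martingale convergence theorem is involved. The same lemma
    gives convergence in probability, and with the bounded second moments it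
    gives convergence in mean ([iterates_converge]).

    Measurability of the iterates rests on the fact that a projection is a limit
    of difference quotients of the squared distance ([proj_coord_cvg]); null sets
    are handled by completeness. *)

(** * Squared Euclidean norms *)

Section euclidean.
Context (R : realType) (N : nat).
Implicit Types (u v w : 'rV[R]_N) (a b e : R).

Definition dotp u v : R := \sum_(i < N) u ord0 i * v ord0 i.

Definition sqn u : R := dotp u u.

Lemma dotpC u v : dotp u v = dotp v u.
Proof. by apply: eq_bigr => i _; rewrite mulrC. Qed.

Lemma dotpDl u v w : dotp (u + v) w = dotp u w + dotp v w.
Proof. by rewrite -big_split; apply: eq_bigr => i _; rewrite mxE mulrDl. Qed.

Lemma dotpZl a u w : dotp (a *: u) w = a * dotp u w.
Proof. by rewrite mulr_sumr; apply: eq_bigr => i _; rewrite mxE mulrA. Qed.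

Lemma dotpNl u w : dotp (- u) w = - dotp u w.
Proof. by rewrite -scaleN1r dotpZl mulN1r. Qed.

Lemma dotpBl u v w : dotp (u - v) w = dotp u w - dotp v w.
Proof. by rewrite dotpDl dotpNl. Qed.

Lemma dotpDr u v w : dotp w (u + v) = dotp w u + dotp w v.
Proof. by rewrite !(dotpC w) dotpDl. Qed.

Lemma dotpZr a u w : dotp w (a *: u) = a * dotp w u.
Proof. by rewrite !(dotpC w) dotpZl. Qed.

Lemma dotpNr u w : dotp w (- u) = - dotp w u.
Proof. by rewrite !(dotpC w) dotpNl. Qed.

Lemma dotpBr u v w : dotp w (u - v) = dotp w u - dotp w v.
Proof. by rewrite !(dotpC w) dotpBl. Qed.

Definition dotpE :=
  (dotpBl, dotpBr, dotpDl, dotpDr, dotpZl, dotpZr, dotpNl, dotpNr).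

Lemma dotp_delta u i : dotp u (delta_mx ord0 i) = u ord0 i.
Proof.
rewrite /dotp (bigD1 i)//= big1 ?addr0 ?mxE ?eqxx ?mulr1// => j /negbTE ji.
by rewrite mxE ji andbF mulr0.
Qed.

Lemma sqn_ge0 u : 0 <= sqn u.
Proof. by apply: sumr_ge0 => i _; rewrite -expr2 sqr_ge0. Qed.

Lemma sqnC u v : sqn (u - v) = sqn (v - u).
Proof. by rewrite /sqn !dotpE; ring. Qed.

(** The difference of the two sides is a squared norm, scaled by [e^-1]. *)
Lemma sqn_young e u v : 0 < e ->
  sqn (u + v) <= (1 + e) * sqn u + (1 + e^-1) * sqn v.
Proof.
move=> e0; have e0' : e != 0 by rewrite gt_eqF.
rewrite -subr_ge0 [X in 0 <= X](_ : _ = e^-1 * sqn (e *: u - v)).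
  by rewrite mulr_ge0 ?sqn_ge0// invr_ge0 ltW.
by rewrite /sqn !dotpE (dotpC v u); field.
Qed.

Lemma sqnD_le u v : sqn (u + v) <= 2 * sqn u + 2 * sqn v.
Proof. by have := sqn_young u v ltr01; rewrite invr1. Qed.

Lemma sqr_enorm u : enorm u ^+ 2 = sqn u.
Proof.
rewrite /enorm sqr_sqrtr; last by apply: sumr_ge0 => i _; rewrite sqr_ge0.
by apply: eq_bigr => i _; rewrite expr2.
Qed.

Lemma enorm_ge0 u : 0 <= enorm u.
Proof. exact: sqrtr_ge0. Qed.

Lemma coord_sqn u i : u ord0 i ^+ 2 <= sqn u.
Proof.
rewrite /sqn /dotp (bigD1 i)//= expr2 lerDl; apply: sumr_ge0 => j _.
by rewrite -expr2 sqr_ge0.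
Qed.

Lemma normr_le_enorm u : `|u| <= enorm u.
Proof.
rewrite [leLHS]mx_normrE; apply: bigmax_le => [|[i j] _]; first exact: enorm_ge0.
rewrite /= ord1 -(@ler_pXn2r _ 2)// ?nnegrE ?enorm_ge0//.
by rewrite sqr_enorm real_normK ?num_real// coord_sqn.
Qed.

Lemma sqn_continuous : continuous sqn.
Proof.
apply: continuous_big => [|i _ u]; first exact: add_continuous.
have ci : w ord0 i @[w --> u] --> u ord0 i by exact: coord_continuous.
exact: (cvgM ci ci).
Qed.

Lemma sqn_dist_continuous v : continuous (fun u => sqn (u - v)).
Proof.
move=> u.
have : w - v @[w --> u] --> u - v.
  by apply: (@cvgB _ 'rV[R]_N _ (nbhs u)); [exact: cvg_id|exact: cvg_cst].
by move=> /continuous_comp; apply; exact: sqn_continuous.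
Qed.

Lemma sqn0 : sqn 0 = 0.
Proof. by rewrite /sqn -(scale0r 0) dotpZl mul0r. Qed.

Lemma sqn_small u e : 0 < e -> \forall v \near u, sqn (u - v) < e.
Proof.
move=> e0.
apply: (@cvgr_lt _ _ (nbhs u) _ (fun v => sqn (u - v)) (sqn (u - u))).
  by under eq_cvg do rewrite sqnC; exact: sqn_dist_continuous.
by rewrite subrr sqn0.
Qed.

(** The estimate in the hypothesis, used in both directions with a small [e],
    bounds [f u - f v]; both the squared distance to a convex set and its mean
    over random sets satisfy it. *)
Lemma young_continuous (f : 'rV[R]_N -> R) : (forall v, 0 <= f v) ->
  (forall e u v, 0 < e -> f u <= (1 + e) * f v + (1 + e^-1) * sqn (u - v)) ->
  continuous f.
Proof.
move=> f0 f_young v; apply/(@cvgrPdist_le _ _ _ (nbhs v)) => /= e e0.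
have M0 : 0 <= f v := f0 v.
(* The parameter h makes the multiplicative error h f v at most e / 4. *)
pose h := Num.min 1 (e / (4 * f v + 4)).
have h0 : 0 < h by rewrite lt_min ltr01 divr_gt0//; lra.
have h1 : h <= 1 by rewrite ge_min lexx.
have hM : h * (4 * f v + 4) <= e.
  by rewrite -ler_pdivlMr ?ge_min ?lexx ?orbT//; lra.
have h'0 : 0 < h^-1 by rewrite invr_gt0.
pose c := 1 + h^-1.
have c0 : 0 < c by rewrite /c; lra.
suff : \forall u \near v, sqn (v - u) < e / (4 * c).
  apply: filterS => u; rewrite ltr_pdivlMr ?mulr_gt0// => ltu.
  have := f_young _ v u h0; have := f_young _ u v h0; rewrite -/c (sqnC u).
  have := sqn_ge0 (v - u); have := f0 u.
  move: (sqn _) (f v) (f u) ltu M0 hM => s M U ltu M0 hM U0 s0 le1 le2.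
  have hU : h * U <= h * ((1 + h) * M + c * s) by rewrite ler_wpM2l// ltW.
  have hhM : h * (h * M) <= h * M by rewrite ler_piMl// mulr_ge0// ltW.
  have hcs : h * (c * s) <= c * s by rewrite ler_piMl// mulr_ge0// ltW.
  by rewrite ler_norml; apply/andP; split; lra.
apply: sqn_small; rewrite divr_gt0// mulr_gt0//.
Qed.

End euclidean.

(** * Projection onto a closed convex set *)

Section projection.
Context (R : realType) (N : nat) (D : set 'rV[R]_N).
Hypothesis hD : nonempty_closed_convex D.
Implicit Types (u v p q h : 'rV[R]_N) (e t : R).

Lemma nearest_point u :
  exists2 p, D p & forall q, D q -> sqn (u - p) <= sqn (u - q).
Proof.
have [[q0 Dq0] cD _] := hD.
(* Only the points of D at least as close as q0 matter, and they form a
   compact set. *)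
pose A := D `&` [set q | sqn (u - q) <= sqn (u - q0)].
have cf : continuous (fun q => sqn (u - q)).
  by under eq_fun do rewrite sqnC; exact: sqn_dist_continuous.
have cA : compact A.
  apply: bounded_closed_compact; last first.
    apply: closedI => //; apply: (preimage_closed _ (@closed_le _ (sqn (u - q0)))).
    by move=> q _; exact: cf.
  exists (`|u| + enorm (u - q0)); split; first exact: num_real.
  move=> r ltr q [_ /= leq]; apply: ltW; apply: le_lt_trans ltr.
  rewrite -[q](subKr u) (le_trans (ler_normB _ _))// lerD2l.
  apply: le_trans (normr_le_enorm _) _.
  by rewrite -(@ler_pXn2r _ 2)// ?nnegrE ?enorm_ge0// !sqr_enorm.
have A0 : A !=set0 by exists q0; split => /=.
have [p] := EVT_min_rV A0 cA (continuous_subspaceT cf).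
rewrite inE => -[Dp lep] minp; exists p => // q Dq.
have [leq|/ltW] := leP (sqn (u - q)) (sqn (u - q0)).
  by apply: minp; rewrite inE.
exact: le_trans.
Qed.

Lemma nearest_dist_set u p : D p -> (forall q, D q -> sqn (u - p) <= sqn (u - q)) ->
  enorm (u - p) = dist_set D u.
Proof.
move=> Dp minp; apply/eqP; rewrite eq_le; apply/andP; split.
  apply: lb_le_inf; first by exists (enorm (u - p)), p.
  move=> _ [q Dq <-].
  by rewrite -(@ler_pXn2r _ 2)// ?nnegrE ?enorm_ge0// !sqr_enorm minp.
apply: ge_inf; last by exists p.
by exists 0 => _ [q _ <-]; exact: enorm_ge0.
Qed.

Lemma proj_setP u : D (proj_set D u) /\ enorm (u - proj_set D u) = dist_set D u.
Proof.
have [p Dp minp] := nearest_point u.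
rewrite /proj_set; case: xgetP => [q -> //|/(_ p)[]].
by split => //; exact: nearest_dist_set.
Qed.

Lemma proj_set_in u : D (proj_set D u).
Proof. by have [] := proj_setP u. Qed.

Lemma sqn_proj u : sqn (u - proj_set D u) = dist_set D u ^+ 2.
Proof. by rewrite -sqr_enorm (proj_setP u).2. Qed.

Lemma dist_set_le u q : D q -> dist_set D u ^+ 2 <= sqn (u - q).
Proof.
move=> Dq; have [p Dp minp] := nearest_point u.
by rewrite -(nearest_dist_set Dp minp) sqr_enorm minp.
Qed.

Lemma convex_comb p q (t : R) : 0 <= t <= 1 -> D p -> D q ->
  D (t *: p + (1 - t) *: q).
Proof.
move=> /andP[t0 t1] Dp Dq; have [_ _ cD] := hD.
have := cD p q (Itv01 t0 t1); rewrite !inE; apply => //.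
Qed.

(** Moving from the projection towards a point of the set does not decrease
    the distance; differentiate along the segment. *)
Lemma proj_obtuse u q : D q -> dotp (u - proj_set D u) (q - proj_set D u) <= 0.
Proof.
set p := proj_set D u => Dq; rewrite leNgt; apply/negP => dot_gt0.
have Dp : D p := proj_set_in u.
set s := sqn (q - p); set c := dotp _ _ in dot_gt0.
have s0 : 0 <= s by exact: sqn_ge0.
(* With step t the squared distance changes by t (t s - 2 c). *)
pose t := c / (c + s).
have cs0 : 0 < c + s by rewrite ltr_wpDr.
have t0 : 0 < t by rewrite divr_gt0.
have t1 : t <= 1 by rewrite ler_pdivrMr// mul1r lerDl.
have := dist_set_le u (convex_comb (introT andP (conj (ltW t0) t1)) Dq Dp).
rewrite -sqn_proj -/p.
rewrite [X in _ <= X -> _](_ : _ = sqn (u - p) + t * (t * s - 2 * c)); last first.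
  rewrite /s /c (_ : u - (_ + _) = (u - p) - t *: (q - p)); last first.
    by apply/rowP => i; rewrite !mxE; ring.
  rewrite /sqn !(dotpBl _ (t *: _), dotpBr _ (t *: _), dotpZl, dotpZr).
  by rewrite (dotpC (q - p) (u - p)); ring.
rewrite lerDl pmulr_rge0// subr_ge0 leNgt => /negP; apply.
rewrite /t mulrAC ltr_pdivrMr//; nra.
Qed.

(** The cross term in the expansion of the right-hand side is nonnegative by
    [proj_obtuse]. *)
Lemma proj_closer u q : D q -> sqn (proj_set D u - q) <= sqn (u - q).
Proof.
move=> Dq; have := proj_obtuse u Dq; have := sqn_ge0 (u - proj_set D u).
rewrite (_ : u - q = (u - proj_set D u) + (proj_set D u - q)); last first.
  by rewrite addrA subrK.
rewrite -(opprB (proj_set D u) q) dotpNr.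
move: (u - proj_set D u) (proj_set D u - q) => a b.
by rewrite /sqn !dotpE (dotpC b a); lra.
Qed.

(** Add the obtuse angle inequalities at the two projections. *)
Lemma proj_nonexpansive u v :
  sqn (proj_set D u - proj_set D v) <= sqn (u - v).
Proof.
set p := proj_set D u; set q := proj_set D v.
have := proj_obtuse u (proj_set_in v); have := proj_obtuse v (proj_set_in u).
rewrite -/p -/q (_ : u - v = (u - p) - (v - q) + (p - q)); last first.
  by apply/rowP => i; rewrite !mxE; ring.
rewrite -(opprB p q) dotpNr.
move: (u - p) (v - q) (p - q) => a b c bc ac.
have := sqn_ge0 (a - b); rewrite /sqn !dotpE (dotpC b a) (dotpC c a) (dotpC c b).
by lra.
Qed.

(** The residual [u - proj_set D u] is half the gradient of the squared
    distance, which is convex. *)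
Lemma dist_subgradient u v :
  dist_set D u ^+ 2 + 2 * dotp (u - proj_set D u) (v - u) <= dist_set D v ^+ 2.
Proof.
rewrite -!sqn_proj; set p := proj_set D u; set q := proj_set D v.
have := proj_obtuse u (proj_set_in v).
rewrite -/p -/q (_ : v - u = (v - q) - (u - p) + (q - p)); last first.
  by apply/rowP => i; rewrite !mxE; ring.
move: (u - p) (v - q) (q - p) => a b c ac.
have := sqn_ge0 (b - a); rewrite /sqn !dotpE (dotpC b a).
by lra.
Qed.

(** Compare with the projection of [u]. *)
Lemma dist_upper u h :
  dist_set D (u + h) ^+ 2
    <= dist_set D u ^+ 2 + 2 * dotp (u - proj_set D u) h + sqn h.
Proof.
apply: le_trans (dist_set_le _ (proj_set_in u)) _.
rewrite -sqn_proj addrAC le_eqVlt; apply/orP; left; apply/eqP.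
by rewrite /sqn (dotpDl _ h) !(dotpDr _ h) (dotpC h); ring.
Qed.

Lemma dist_young e u v : 0 < e -> dist_set D u ^+ 2 <=
  (1 + e) * dist_set D v ^+ 2 + (1 + e^-1) * sqn (u - v).
Proof.
move=> e0; apply: le_trans (dist_set_le _ (proj_set_in v)) _.
rewrite -sqn_proj (_ : u - _ = (v - proj_set D v) + (u - v)).
  exact: sqn_young.
by rewrite [RHS]addrC addrA subrK.
Qed.

(** A relaxed projection is a gradient step of length [t] for half the squared
    distance: the first-order term is bounded by convexity, and the squared
    length of the step, [t ^+ 2 * dist_set D u ^+ 2], by [dist_young]. *)
Lemma relaxed_projection_le u z (t : R) : 0 <= t ->
  sqn ((1 - t) *: u + t *: proj_set D u - z) + t * dist_set D u ^+ 2 <=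
  (1 + 2 * t ^+ 2) * sqn (u - z) + (t + 2 * t ^+ 2) * dist_set D z ^+ 2.
Proof.
move=> t0; have sub := dist_subgradient u z.
have := dist_young u z ltr01; rewrite invr1 => le2.
have : t ^+ 2 * dist_set D u ^+ 2 <=
    t ^+ 2 * ((1 + 1) * dist_set D z ^+ 2 + (1 + 1) * sqn (u - z)).
  by rewrite ler_wpM2l// sqr_ge0.
have : t * (dist_set D u ^+ 2 + 2 * dotp (u - proj_set D u) (z - u)) <=
    t * dist_set D z ^+ 2 by rewrite ler_wpM2l.
rewrite (_ : _ + _ - z = (u - z) - t *: (u - proj_set D u)); last first.
  by apply/rowP => i; rewrite !mxE; ring.
rewrite -[z - u]opprB -!sqn_proj.
move: (u - proj_set D u) (u - z) (z - proj_set D z) => a b c.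
by rewrite /sqn !dotpE (dotpC b a); lra.
Qed.

Lemma dist_convex u v t : 0 <= t <= 1 ->
  dist_set D (t *: u + (1 - t) *: v) ^+ 2
    <= t * dist_set D u ^+ 2 + (1 - t) * dist_set D v ^+ 2.
Proof.
move=> t01; have /andP[t0 t1] := t01.
apply: le_trans (dist_set_le _ (convex_comb t01 (proj_set_in u) (proj_set_in v))) _.
rewrite -!sqn_proj; set a := u - _; set b := v - _.
rewrite (_ : _ - _ = t *: a + (1 - t) *: b); last first.
  by rewrite /a /b !scalerBr addrACA -opprD.
rewrite -subr_ge0 [X in 0 <= X](_ : _ = t * (1 - t) * sqn (a - b)).
  by rewrite mulr_ge0 ?sqn_ge0// mulr_ge0// subr_ge0.
by move: a b => a b; rewrite /sqn !dotpE (dotpC b a); ring.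
Qed.

Lemma dist_sq_continuous : continuous (fun u => dist_set D u ^+ 2).
Proof.
apply: young_continuous => [v|e u v]; first exact: sqr_ge0.
exact: dist_young.
Qed.

(** The difference quotients of the squared distance lie between its two first
    order bounds, so the projection is determined by values of that function
    alone; this is what makes a projection onto a random set measurable. *)
Lemma proj_coord_cvg u i :
  n.+1%:R / 2 * (dist_set D (u + n.+1%:R^-1 *: delta_mx ord0 i) ^+ 2
      - dist_set D u ^+ 2) @[n --> \oo] --> (u - proj_set D u) ord0 i.
Proof.
pose g : R := (u - proj_set D u) ord0 i.
rewrite -[X in _ --> X]/g.
have gE n : dotp (u - proj_set D u) (n.+1%:R^-1 *: delta_mx ord0 i) =
    n.+1%:R^-1 * g.
  by rewrite dotpZr dotp_delta.
have dE : sqn (delta_mx ord0 i : 'rV[R]_N) = 1.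
  by rewrite /sqn dotp_delta mxE !eqxx.
apply: (@squeeze_cvgr _ _ _ _ (cst g) (fun n => g + n.+1%:R^-1 / 2)).
- apply: nearW => n /=.
  have := dist_subgradient u (u + n.+1%:R^-1 *: delta_mx ord0 i).
  have := dist_upper u (n.+1%:R^-1 *: delta_mx ord0 i).
  rewrite [_ + _ - u]addrC addKr gE /sqn dotpZl dotpZr -/(sqn _) dE mulr1.
  move: (dist_set D (u + _) ^+ 2) (dist_set D u ^+ 2) => s t.
  have : 0 < n.+1%:R :> R by rewrite ltr0n.
  move: (n.+1%:R) => k k0 ub lb.
  have k1 : k * k^-1 = 1 by rewrite divff// gt_eqF.
  have k'0 : 0 <= k^-1 by rewrite invr_ge0 ltW.
  move: k^-1 k1 k'0 ub lb => k' k1 k'0 ub lb.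
  have := ler_wpM2l (ltW k0) lb; have := ler_wpM2l (ltW k0) ub.
  rewrite !mulrDr !(mulrCA k 2) !(mulrA k k') k1 !mul1r.
  by move=> *; apply/andP; split; lra.
- exact: cvg_cst.
- rewrite -[X in _ --> X]addr0 -[X in _ + X](mul0r 2^-1).
  by apply: cvgD; [exact: cvg_cst|apply: cvgMl; exact: cvg_harmonic].
Qed.

End projection.

(** * Measurable vectors *)

Section borel_vectors.
Context (R : realType) (N : nat).

Lemma continuous_measurable_rV (f : 'rV[R]_N -> R) :
  continuous f -> measurable_fun [set: borelRV R N] (f : borelRV R N -> R).
Proof.
move=> /continuousP cf; apply: (measurability _ (RGenOpens.measurableE R)).
move=> _ [_ [a [b ->]] <-]; rewrite setTI.
by apply: sub_sigma_algebra; apply: cf; exact: interval_open.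
Qed.

Local Notation ratv q := (map_mx ratr q : 'rV[R]_N).

(** A countable base of open sets, each a box in the coordinates, is what reduces
    Borel measurability to the measurability of the coordinates. *)
Lemma open_rat_balls (U : set 'rV[R]_N) : open U ->
  U = \bigcup_(c in [set c : 'rV[rat]_N * nat |
                     ball (ratv c.1) c.2.+1%:R^-1 `<=` U])
      ball (ratv c.1) c.2.+1%:R^-1.
Proof.
move=> oU; apply/seteqP; split => [v Uv|v [c /= cU]]; last exact: cU.
have /nbhs_ballP[e /= e0 eU] : nbhs v U by exact: open_nbhs_nbhs.
have [m me] : exists m, m.+1%:R^-1 < e / 2.
  have e2 : 0 < e / 2 by rewrite divr_gt0.
  have [m _ /(_ m (leqnn m)) me] := near_infty_natSinv_lt (PosNum e2).
  by exists m.
have qP i : exists q : rat, v ord0 i - m.+1%:R^-1 < ratr q < v ord0 i + m.+1%:R^-1.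
  have /rat_in_itvoo[q] : v ord0 i - m.+1%:R^-1 < v ord0 i + m.+1%:R^-1.
    by rewrite ltrD2l gtrN ?invr_gt0.
  by rewrite in_itv /=; exists q.
have {qP}[q qP] := choice qP.
have vq : ball (ratv (\row_i q i)) m.+1%:R^-1 v.
  split; first by rewrite invr_gt0.
  move=> i j; rewrite ord1 !mxE; have := qP j.
  by rewrite -ball_normE /= ltr_distl.
exists (\row_i q i, m) => //= w qw; apply: eU.
rewrite (splitr e); apply: (ball_triangle (y := ratv (\row_i q i))).
  by apply: le_ball (ltW me) _ _; exact: ball_sym.
exact: le_ball (ltW me) _ qw.
Qed.

Lemma measurable_rVP d (T : measurableType d) (u : T -> 'rV[R]_N) :
  measurable_fun setT (u : T -> borelRV R N) <->
  forall i, measurable_fun setT (fun w => u w ord0 i).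
Proof.
split=> [mu i|mu].
  have := continuous_measurable_rV (@coord_continuous R 1 N ord0 i).
  by move=> /measurableT_comp; apply.
apply: (@measurability _ _ T (borelRV R N) _ _ (@open 'rV[R]_N)) => //.
move=> _ [U oU <-]; rewrite setTI.
rewrite (open_rat_balls oU) preimage_bigcup bigcup_mkcond.
apply: countable_bigcupT_measurable => // c; case: ifPn => // _.
rewrite (_ : _ @^-1` _ = \bigcap_(i in [set: 'I_N])
    (fun w => u w ord0 i) @^-1` ball (ratr (c.1 ord0 i) : R) c.2.+1%:R^-1).
  apply: fin_bigcap_measurable => // i _.
  rewrite -[X in measurable X]setTI; apply: mu => //.
  by rewrite -ball_normE; exact: measurable_ball.
apply/seteqP; split => [w [_ /= h] i _|w h] /=.
  by have := h ord0 i; rewrite mxE.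
by split=> [|i j]; rewrite ?invr_gt0// ord1 mxE; exact: h.
Qed.

End borel_vectors.

Section measurable_vector_operations.
Context d (T : measurableType d) (R : realType) (N : nat).
Implicit Types u v : T -> 'rV[R]_N.

(** Measurability for the Borel sigma-algebra, in the form that is stable under
    the vector operations; see [measurable_rVP]. *)
Definition meas_vec u :=
  forall i, measurable_fun [set: T] (fun w => u w ord0 i).

Lemma meas_vec_cst (a : 'rV[R]_N) : meas_vec (fun=> a).
Proof. by move=> i; exact: measurable_cst. Qed.

Lemma meas_vecD u v : meas_vec u -> meas_vec v -> meas_vec (fun w => u w + v w).
Proof.
move=> mu mv i; under eq_fun do rewrite mxE.
exact: measurable_funD.
Qed.

Lemma meas_vecZ (a : R) u : meas_vec u -> meas_vec (fun w => a *: u w).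
Proof.
move=> mu i; under eq_fun do rewrite mxE.
by apply: measurable_funM => //; exact: measurable_cst.
Qed.

Lemma meas_vecB u v : meas_vec u -> meas_vec v -> meas_vec (fun w => u w - v w).
Proof.
move=> mu mv; have := meas_vecD mu (meas_vecZ (-1) mv).
by under eq_fun do rewrite scaleN1r.
Qed.

Lemma meas_comp_continuous (f : 'rV[R]_N -> R) u : continuous f ->
  meas_vec u -> measurable_fun [set: T] (fun w => f (u w)).
Proof.
move=> cf /measurable_rVP mu.
exact: (measurableT_comp (continuous_measurable_rV cf) mu).
Qed.

Lemma meas_sqn u : meas_vec u -> measurable_fun [set: T] (fun w => sqn (u w)).
Proof.
exact: meas_comp_continuous (@sqn_continuous R N).
Qed.

Lemma meas_enorm u : meas_vec u -> measurable_fun [set: T] (fun w => enorm (u w)).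
Proof.
move=> /meas_sqn.
exact: (measurableT_comp (continuous_measurable_fun (@sqrt_continuous R))).
Qed.

Lemma meas_vec_proj (D : set 'rV[R]_N) u : nonempty_closed_convex D ->
  meas_vec u -> meas_vec (fun w => proj_set D (u w)).
Proof.
move=> hD mu i.
have cp : continuous (fun a : 'rV[R]_N => proj_set D a ord0 i).
  move=> v; apply/(@cvgrPdist_le _ _ _ (nbhs v)) => /= e e0.
  suff : \forall v' \near v, sqn (v - v') < e ^+ 2.
    apply: filterS => v' lte; rewrite -(@ler_pXn2r _ 2)// ?nnegrE ?(ltW e0)//.
    rewrite real_normK ?num_real//; apply: le_trans (ltW lte).
    apply: le_trans (proj_nonexpansive hD v v').
    by have := coord_sqn (proj_set D v - proj_set D v') i; rewrite !mxE.
  by apply: sqn_small; rewrite exprn_gt0.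
exact: (meas_comp_continuous cp mu).
Qed.

End measurable_vector_operations.

Section measurable_random_projection.
Context (R : realType) (N : nat) d (T : measurableType d).
Context d' (K : measurableType d') (Z : K -> set 'rV[R]_N).
Hypothesis hZ : forall kappa, nonempty_closed_convex (Z kappa).
Hypothesis T_meas : measurable_fun [set: K * borelRV R N]
     (fun z : K * borelRV R N => Tfun Z z.1 z.2).

Lemma measurable_Tfun (k : T -> K) (u : T -> 'rV[R]_N) :
  measurable_fun setT k -> meas_vec u ->
  measurable_fun setT (fun w => Tfun Z (k w) (u w)).
Proof.
move=> mk /measurable_rVP mu.
exact: (measurableT_comp T_meas (measurable_fun_pair mk mu)).
Qed.

(** The squared distance is jointly measurable, hence so is the limit of its
    difference quotients. *)
Lemma meas_vec_random_proj (k : T -> K) (u : T -> 'rV[R]_N) :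
  measurable_fun setT k -> meas_vec u ->
  meas_vec (fun w => proj_set (Z (k w)) (u w)).
Proof.
move=> mk mu.
suff : meas_vec (fun w => u w - proj_set (Z (k w)) (u w)).
  by move=> /(meas_vecB mu); under eq_fun do rewrite subKr.
move=> i; apply: (measurable_fun_cvg (h := fun n w =>
    n.+1%:R / 2 * (Tfun Z (k w) (u w + n.+1%:R^-1 *: delta_mx ord0 i)
      - Tfun Z (k w) (u w)))); last first.
  by move=> w _; exact: (@proj_coord_cvg _ _ _ (hZ (k w)) (u w) i).
move=> n; apply: measurable_funM; first exact: measurable_cst.
apply: measurable_funB; last exact: measurable_Tfun.
by apply: measurable_Tfun => //; apply: meas_vecD => //; exact: meas_vec_cst.
Qed.

End measurable_random_projection.

(** * Integrating out an independent variable *)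

Section freezing.
Context d (Omega : measurableType d) (R : realType) (P : probability Omega R).
Context d' (K : measurableType d') (X : {RV P >-> K}).
Variable G : set (set Omega).
Hypothesis G_meas : <<s G >> `<=` @measurable _ Omega.
Hypothesis X_indep : independent_of X <<s G >>.
Local Open Scope ereal_scope.

Local Notation OmegaG := (g_sigma_algebraType G).

(* The space Omega with the coarser sigma-algebra; the pair formed by X and
   this identity map has a product law. *)
Let idG : Omega -> OmegaG := id.

Let measurable_idG : measurable_fun setT idG.
Proof. by move=> _ A mA; rewrite setTI; exact: G_meas. Qed.

HB.instance Definition _ :=
  isMeasurableFun.Build _ _ _ _ idG measurable_idG.

Let pairG (w : Omega) : K * OmegaG := (X w, idG w).

Let measurable_pairG : measurable_fun setT pairG.
Proof. exact: measurable_fun_pair. Qed.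

HB.instance Definition _ :=
  isMeasurableFun.Build _ _ _ _ pairG measurable_pairG.

(** Independence says that the joint law of [X] and of the point of [Omega],
    seen through the sigma-algebra generated by [G], is a product measure. *)
Lemma integral_freezing (Phi : K * OmegaG -> \bar R) :
  measurable_fun setT Phi -> (forall z, 0 <= Phi z) ->
  \int[P]_w Phi (X w, w) = \int[P]_w \int[distribution P X]_kappa Phi (kappa, w).
Proof.
move=> mPhi Phi0.
have mG := measurable_fun_fubini_tonelli_G (m1 := distribution P X) Phi mPhi Phi0.
rewrite -(ge0_integral_distribution pairG mPhi Phi0).
rewrite (eq_measure_integral (distribution P X \x distribution P idG)); last first.
  move=> A mA _; apply/esym.
  by apply: (product_measure_unique (m' := distribution P pairG)) => //;
    exact: X_indep.
rewrite fubini_tonelli2// (ge0_integral_distribution idG mG)// => w.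
exact: integral_ge0.
Qed.

End freezing.

(** * Integrals of nonnegative affine combinations *)

Section nonneg_combination.
Context d (Omega : measurableType d) (R : realType) (P : probability Omega R).
Variable A : set Omega.
Hypothesis mA : measurable A.
Implicit Types f g h : Omega -> R.

Lemma ge0_integral_comb f g (a b c : R) :
  measurable_fun setT f -> measurable_fun setT g ->
  (forall w, 0 <= f w) -> (forall w, 0 <= g w) ->
  0 <= a -> 0 <= b -> 0 <= c ->
  (\int[P]_(w in A) (a * f w + b * g w + c)%:E =
   a%:E * (\int[P]_(w in A) (f w)%:E) + b%:E * (\int[P]_(w in A) (g w)%:E)
     + c%:E * P A)%E.
Proof.
move=> mf mg f0 g0 a0 b0 c0.
have mE (h : Omega -> R) : measurable_fun setT h ->
    measurable_fun A (fun w => (h w)%:E).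
  by move=> mh; apply/measurable_EFinP; exact: measurable_funTS.
have m2 (h : Omega -> R) (t : R) : measurable_fun setT h ->
    measurable_fun setT (fun w => t * h w).
  by move=> mh; apply: measurable_funM => //; exact: measurable_cst.
under eq_integral do rewrite EFinD.
rewrite ge0_integralD//=; last 2 first.
- by move=> w _; rewrite lee_fin addr_ge0// mulr_ge0.
- by apply: (mE (fun w => a * f w + b * g w)); apply: measurable_funD; exact: m2.
rewrite integral_cst//; congr (_ + _)%E.
under eq_integral do rewrite EFinD.
rewrite ge0_integralD//=; last 4 first.
- by move=> w _; rewrite lee_fin mulr_ge0.
- exact: (mE _ (m2 _ _ mf)).
- by move=> w _; rewrite lee_fin mulr_ge0.
- exact: (mE _ (m2 _ _ mg)).
under eq_integral do rewrite EFinM.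
rewrite ge0_integralZl_EFin//; last 2 first.
- by move=> w _; rewrite lee_fin.
- exact: mE.
congr (_ + _)%E.
under eq_integral do rewrite EFinM.
rewrite ge0_integralZl_EFin//.
- by move=> w _; rewrite lee_fin.
- exact: mE.
Qed.

Lemma ge0_integral_le_comb h f g (a b c : R) :
  measurable_fun setT h -> measurable_fun setT f -> measurable_fun setT g ->
  (forall w, 0 <= h w) -> (forall w, 0 <= f w) -> (forall w, 0 <= g w) ->
  0 <= a -> 0 <= b -> 0 <= c ->
  {ae P, forall w, h w <= a * f w + b * g w + c} ->
  (\int[P]_(w in A) (h w)%:E <=
   a%:E * (\int[P]_(w in A) (f w)%:E) + b%:E * (\int[P]_(w in A) (g w)%:E)
     + c%:E * P A)%E.
Proof.
move=> mh mf mg h0 f0 g0 a0 b0 c0 hle.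
rewrite -ge0_integral_comb//.
have mE (u : Omega -> R) : measurable_fun setT u ->
    measurable_fun A (fun w => (u w)%:E).
  by move=> mu; apply/measurable_EFinP; exact: measurable_funTS.
apply: ae_ge0_le_integral => //.
- by move=> w _; rewrite lee_fin.
- exact: mE.
- by move=> w _; rewrite lee_fin !addr_ge0// mulr_ge0.
- apply: (mE (fun w => a * f w + b * g w + c)).
  by do !apply: measurable_funD => //; apply: measurable_funM.
- by apply: filterS hle => w + _; rewrite lee_fin.
Qed.

End nonneg_combination.

Lemma integral_prob_cst d (Omega : measurableType d) (R : realType)
  (P : probability Omega R) (c : R) : (\int[P]_w c%:E = c%:E)%E.
Proof.
rewrite integral_cst//; transitivity (c%:E * P [set: Omega])%E => //.
by rewrite probability_setT mule1.
Qed.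

Lemma ge0_mean_le_comb d (Omega : measurableType d) (R : realType)
  (P : probability Omega R) (h f g : Omega -> R) (a b c : R) :
  measurable_fun setT h -> measurable_fun setT f -> measurable_fun setT g ->
  (forall w, 0 <= h w) -> (forall w, 0 <= f w) -> (forall w, 0 <= g w) ->
  0 <= a -> 0 <= b -> 0 <= c ->
  {ae P, forall w, h w <= a * f w + b * g w + c} ->
  (\int[P]_w (h w)%:E <=
   a%:E * (\int[P]_w (f w)%:E) + b%:E * (\int[P]_w (g w)%:E) + c%:E)%E.
Proof.
move=> mh mf mg h0 f0 g0 a0 b0 c0 hle.
have := ge0_integral_le_comb measurableT mh mf mg h0 f0 g0 a0 b0 c0 hle.
by rewrite -integral_cst// integral_prob_cst.
Qed.

(** * The risk function and the solution set *)

Lemma convex_set_of_comb (R : realType) (N : nat) (D : set 'rV[R]_N) :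
  (forall p q (t : R), 0 <= t <= 1 -> D p -> D q -> D (t *: p + (1 - t) *: q)) ->
  convex_set (D : set (convex_lmodType 'rV[R]_N)).
Proof.
move=> cD p q l; rewrite !inE => Dp Dq; apply: cD => //.
by apply/andP; split; [exact: ge0|exact: le1].
Qed.

Section risk.
Context (R : realType) (N : nat).
Context d (Omega : measurableType d) (P : probability Omega R).
Context d' (K : measurableType d') (k : {RV P >-> K}).
Variable Z : K -> set 'rV[R]_N.
Hypothesis hZ : forall kappa, nonempty_closed_convex (Z kappa).
Hypothesis T_meas : measurable_fun [set: K * borelRV R N]
     (fun z : K * borelRV R N => Tfun Z z.1 z.2).
Hypothesis T0_int : ('E_P[(fun w => Tfun Z (k w) 0%R)] < +oo)%E.
Implicit Types (u v : 'rV[R]_N) (e t : R).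

Definition risk u : R := fine (\int[P]_w (Tfun Z (k w) u)%:E)%E.

Let mT u : measurable_fun setT (fun w => Tfun Z (k w) u).
Proof. by apply: measurable_Tfun => //; exact: meas_vec_cst. Qed.

Let T_ge0 kappa u : 0 <= Tfun Z kappa u.
Proof. exact: sqr_ge0. Qed.

(** Integrability at one point spreads to all points by [dist_young]. *)
Lemma riskE u : (\int[P]_w (Tfun Z (k w) u)%:E = (risk u)%:E)%E.
Proof.
rewrite fineK// ge0_fin_numE; last by apply: integral_ge0 => w _; rewrite lee_fin.
have := ge0_mean_le_comb (P := P) (mT u) (mT 0)
  (measurable_cst (0 : R)) (fun w => T_ge0 (k w) u) (fun w => T_ge0 (k w) 0)
  (fun=> lexx 0) (ler0n _ 2) (lexx 0) (mulr_ge0 (ler0n _ 2) (sqn_ge0 u)).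
move=> /(_ _)/le_lt_trans; apply.
  apply: nearW => w; rewrite mul0r addr0.
  have := dist_young (hZ (k w)) u 0 ltr01.
  by rewrite invr1 subr0.
rewrite mul0e adde0 lte_add_pinfty ?ltry//.
by rewrite lte_mul_pinfty//; move: T0_int; rewrite unlock.
Qed.

Lemma risk_ge0 u : 0 <= risk u.
Proof.
by rewrite -lee_fin -riskE; apply: integral_ge0 => w _; rewrite lee_fin.
Qed.

Lemma risk_young e u v : 0 < e ->
  risk u <= (1 + e) * risk v + (1 + e^-1) * sqn (u - v).
Proof.
move=> e0; have e'0 : 0 < e^-1 by rewrite invr_gt0.
have := ge0_mean_le_comb (P := P) (a := 1 + e) (b := 0)
  (c := (1 + e^-1) * sqn (u - v)) (mT u) (mT v)
  (measurable_cst (0 : R)) (fun w => T_ge0 (k w) u) (fun w => T_ge0 (k w) v)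
  (fun=> lexx 0).
rewrite !riskE mul0e adde0 -EFinM -EFinD lee_fin; apply => //.
- by rewrite addr_ge0// ltW.
- by rewrite mulr_ge0 ?sqn_ge0// addr_ge0// ltW.
- by apply: nearW => w; rewrite mul0r addr0; exact: dist_young.
Qed.

Lemma risk_convex t u v : 0 <= t <= 1 ->
  risk (t *: u + (1 - t) *: v) <= t * risk u + (1 - t) * risk v.
Proof.
move=> t01; have /andP[t0 t1] := t01.
have := ge0_mean_le_comb (P := P) (a := t) (b := 1 - t) (c := 0)
  (mT (t *: u + (1 - t) *: v)) (mT u) (mT v)
  (fun w => T_ge0 (k w) _) (fun w => T_ge0 (k w) u) (fun w => T_ge0 (k w) v).
rewrite !riskE adde0 -!EFinM -EFinD lee_fin; apply => //.
- by rewrite subr_ge0.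
- by apply: nearW => w; rewrite addr0; exact: dist_convex.
Qed.

Lemma risk_continuous : continuous risk.
Proof. exact: young_continuous risk_ge0 risk_young. Qed.

Lemma half_riskE u :
  (\int[P]_w (2^-1 * dist_set (Z (k w)) u ^+ 2)%:E = (2^-1 * risk u)%:E)%E.
Proof.
under eq_integral do rewrite EFinM.
rewrite ge0_integralZl_EFin//.
- by rewrite riskE.
- by move=> w _; rewrite lee_fin sqr_ge0.
- by apply/measurable_EFinP; exact: mT.
Qed.

Lemma solutionsE (C : set 'rV[R]_N) :
  solutions k Z C = argmin C (fun u => (risk u)%:E).
Proof.
have hE u v : ((\int[P]_w (2^-1 * dist_set (Z (k w)) u ^+ 2)%:E <=
    \int[P]_w (2^-1 * dist_set (Z (k w)) v ^+ 2)%:E)%E =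
    ((risk u)%:E <= (risk v)%:E)%E).
  by rewrite (half_riskE u) (half_riskE v) !lee_fin ler_pM2l// invr_gt0.
apply/seteqP; split=> u -[Cu uP]; (split; first exact: Cu) => v Cv.
  by have := uP v Cv; rewrite /= hE.
by rewrite /= hE; exact: uP.
Qed.

End risk.

Section minimizers.
Context (R : realType) (N : nat).
Variables (f : 'rV[R]_N -> R) (C : set 'rV[R]_N).
Hypothesis f_cont : continuous f.
Hypothesis f_convex : forall (t : R) u v, 0 <= t <= 1 ->
  f (t *: u + (1 - t) *: v) <= t * f u + (1 - t) * f v.
Hypothesis hC : nonempty_closed_convex C.
Implicit Types (u v : 'rV[R]_N).

Local Notation fE := (fun u => (f u)%:E).

Lemma argminP u : argmin C fE u <-> C u /\ forall v, C v -> f u <= f v.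
Proof.
by split=> -[Cu uP]; split => // v Cv; move: (uP v Cv); rewrite lee_fin.
Qed.

Lemma argmin_eq u v : argmin C fE u -> argmin C fE v -> f u = f v.
Proof.
move=> /argminP[Cu uP] /argminP[Cv vP].
by apply/eqP; rewrite eq_le uP// vP.
Qed.

Lemma argmin_nonempty_closed_convex :
  argmin C fE !=set0 -> nonempty_closed_convex (argmin C fE).
Proof.
move=> [s Ss]; have [_ cC _] := hC.
have SE : argmin C fE = C `&` (f @^-1` [set r | r <= f s]).
  have /argminP[Cs sP] := Ss.
  apply/seteqP; split => [v Sv|v [Cv /= vs]].
    by split => /=; [have [] := Sv|rewrite (argmin_eq Sv Ss)].
  by apply/argminP; split => // q Cq; exact: le_trans vs (sP _ Cq).
split; first by exists s.
- rewrite SE; apply: closedI => //; apply: (preimage_closed _ (@closed_le _ _)).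
  by move=> v _; exact: f_cont.
- apply: convex_set_of_comb => p q t t01; rewrite SE => -[Cp /= ps] [Cq /= qs].
  split; first exact: (convex_comb hC).
  have /andP[t0 t1] := t01.
  rewrite /= (le_trans (f_convex p q t01))//.
  have : t * f p <= t * f s by exact: ler_wpM2l.
  have : (1 - t) * f q <= (1 - t) * f s by rewrite ler_wpM2l// subr_ge0.
  by lra.
Qed.

(** By compactness, on bounded subsets of [C] a nearly optimal value forces
    proximity to the set of minimizers. *)
Lemma argmin_gap s (r dl : R) : argmin C fE s -> 0 < dl ->
  exists2 e, 0 < e & forall v, C v -> sqn (v - s) <= r -> f v <= f s + e ->
    sqn (v - proj_set (argmin C fE) v) < dl.
Proof.
move=> Ss dl0; have [_ cC _] := hC; have /argminP[Cs sP] := Ss.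
have hS := argmin_nonempty_closed_convex (ex_intro _ s Ss).
set S := argmin C fE in hS *.
pose A := C `&` [set v | sqn (v - s) <= r] `&` [set v | dl <= dist_set S v ^+ 2].
have [[v0 Av0]|A0] := pselect (A !=set0); last first.
  exists 1 => // v Cv vr _; rewrite ltNge; apply/negP => dlv.
  by apply: A0; exists v; split => //=; rewrite -sqn_proj.
have cA : compact A.
  apply: bounded_closed_compact.
    exists (`|s| + Num.sqrt r); split; first exact: num_real.
    move=> q ltq v [[_ /= vr] _]; apply: ltW; apply: le_lt_trans ltq.
    rewrite -[v](subrKC s) (le_trans (ler_normD _ _))// lerD2l.
    by apply: le_trans (normr_le_enorm _) _; rewrite /enorm ler_wsqrtr.
  apply: closedI; first apply: closedI => //.
    apply: (preimage_closed _ (@closed_le _ _)) => v _; exact: sqn_dist_continuous.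
  apply: (preimage_closed _ (@closed_ge _ _)) => v _; exact: dist_sq_continuous.
have [v1] := EVT_min_rV (ex_intro _ v0 Av0) cA (continuous_subspaceT f_cont).
rewrite inE => -[[Cv1 _] /= dlv1] minv1.
have gap : f s < f v1.
  rewrite lt_neqAle sP// andbT; apply/eqP => sv1.
  have Sv1 : S v1 by apply/argminP; split => // q Cq; rewrite -sv1 sP.
  move: dlv1; rewrite leNgt => /negP; apply.
  by apply: le_lt_trans (dist_set_le hS v1 Sv1) _; rewrite subrr sqn0.
exists ((f v1 - f s) / 2); first by rewrite divr_gt0// subr_gt0.
move=> v Cv vr; apply: contraTT; rewrite -leNgt -ltNge => dlv.
have Av : A v by split => //=; rewrite -sqn_proj.
have := minv1 v; rewrite inE => /(_ Av); lra.
Qed.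

End minimizers.

(** * A deterministic descent recursion *)

Section series_of_reals.
Context (R : realType).

Lemma partial_sums_unbounded (u : nat -> R) (B : R) j : (forall n, 0 < u n) ->
  (\sum_(0 <= n <oo) (u n)%:E = +oo)%E ->
  exists n, B < \sum_(j <= i < n) u i.
Proof.
move=> u0 sum_u; apply: contrapT => /forallNP h.
suff : (\sum_(0 <= n <oo) (u n)%:E <= (B + \sum_(0 <= i < j) u i)%:E)%E.
  by rewrite sum_u leye_eq.
clear sum_u.
apply: lime_le.
  by apply: is_cvg_nneseries => n _ _; rewrite lee_fin ltW.
apply: nearW => n; rewrite sumEFin lee_fin.
have hj : \sum_(j <= i < n) u i <= B by rewrite leNgt; apply/negP; exact: h.
have [jn|nj] := leqP j n.
  by rewrite (big_cat_nat (n := j))//= addrC lerD2r.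
have B0 : 0 <= B by apply: le_trans hj; rewrite big_geq// ltnW.
rewrite [in leRHS](big_cat_nat (leq0n n) (ltnW nj)) /= addrCA lerDl addr_ge0//.
by apply: sumr_ge0 => i _; exact: ltW.
Qed.

Lemma small_tails (u : nat -> R) (e : R) : (forall n, 0 <= u n) ->
  (\sum_(0 <= n <oo) (u n)%:E < +oo)%E -> 0 < e ->
  exists j, forall n, \sum_(j <= i < n) u i <= e.
Proof.
move=> u0 sum_u e0.
have cv : cvgn (fun n => \sum_(0 <= i < n) u i).
  apply: nondecreasing_is_cvgn.
    by clear sum_u; apply/nondecreasing_seqP => n; rewrite big_nat_recr//= lerDl.
  exists (fine (\sum_(0 <= n <oo) (u n)%:E)%E) => _ [n _ <-].
  rewrite -lee_fin fineK; last first.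
    rewrite ge0_fin_numE; first exact: sum_u.
    by clear sum_u; apply: nneseries_ge0 => i _ _; rewrite lee_fin.
  clear sum_u; rewrite -sumEFin; apply: nneseries_lim_ge => i _ _.
  by rewrite lee_fin.
clear sum_u.
have /cvgrPdist_lt/(_ _ (divr_gt0 e0 (ltr0n _ 2))) [j _ jP] := cv.
exists j => n; have [jn|nj] := leqP j n; last by rewrite big_geq ?ltW// ltnW.
have := jP _ (leqnn j); have := jP _ jn.
rewrite /= (big_cat_nat (n := j) (p := n))//=.
move: (limn _) (\sum_(0 <= i < j) _) (\sum_(j <= i < n) _) => l s t.
by rewrite !ltr_norml => /andP[? ?] /andP[? ?]; lra.
Qed.

End series_of_reals.

(** [a] stands for the mean squared distance to a solution, and [b] for the mean
    value of the objective above its minimum [m]. *)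
Section descent_recursion.
Context (R : realType).
Variables (gamma a b : nat -> R) (m : R).
Hypothesis gamma_gt0 : forall n, 0 < gamma n.
Hypothesis gamma_unbounded :
  forall B j, exists n, B < \sum_(j <= i < n) gamma i.
Hypothesis gamma2_tails : forall e, 0 < e ->
  exists j, forall n, \sum_(j <= i < n) gamma i ^+ 2 <= e.
Hypothesis a_ge0 : forall n, 0 <= a n.
Hypothesis b_ge0 : forall n, 0 <= b n.
Hypothesis m_ge0 : 0 <= m.
Hypothesis ab_rec : forall n,
  a n.+1 + gamma n * b n <= (1 + 2 * gamma n ^+ 2) * a n + 2 * gamma n ^+ 2 * m.

(** Adding [m] to [a] makes the recursion multiplicative. *)
Lemma descent_bounded : exists M, forall n, a n <= M.
Proof.
have [j jP] := gamma2_tails ltr01.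
pose s n := \sum_(0 <= i < n) gamma i ^+ 2.
have s_le n : s n <= s j + 1.
  have [jn|nj] := leqP j n.
    by rewrite /s (big_cat_nat (n := j))//= lerD2l.
  rewrite /s [in leRHS](big_cat_nat (leq0n n) (ltnW nj)) /= -addrA lerDl addr_ge0//.
  by apply: sumr_ge0 => i _; exact: sqr_ge0.
exists ((a 0 + m) * expR (2 * (s j + 1))) => n.
apply: (@le_trans _ _ ((a 0 + m) * expR (2 * s n))); last first.
  by rewrite ler_wpM2l ?addr_ge0// ler_expR ler_pM2l.
apply: (@le_trans _ _ (a n + m)); first by rewrite lerDl.
elim: n => [|n ih]; first by rewrite /s big_geq// mulr0 expR0 mulr1.
have g2 : 0 <= gamma n ^+ 2 by exact: sqr_ge0.
apply: (@le_trans _ _ ((1 + 2 * gamma n ^+ 2) * (a n + m))).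
  have := ab_rec n; have : 0 <= gamma n * b n by rewrite mulr_ge0// ltW.
  by rewrite mulrDr; lra.
rewrite /s big_nat_recr//= [2 * (_ + _)]mulrDr expRD mulrA mulrC ler_pM//.
- by rewrite addr_ge0.
- by rewrite addr_ge0// mulr_ge0.
- exact: expR_ge1Dx.
Qed.

(** Otherwise the sum of the recursions would bound the partial sums of
    [gamma]. *)
Lemma descent_small e j : 0 < e -> exists2 n, (j <= n)%N & b n < e.
Proof.
move=> e0; apply: contrapT => h.
have {}h n : (j <= n)%N -> e <= b n.
  by move=> jn; rewrite leNgt; apply/negP => lt; apply: h; exists n.
have [M MP] := descent_bounded.
have [j2 j2P] := gamma2_tails ltr01.
pose i0 := maxn j j2.
have M0 : 0 <= M := le_trans (a_ge0 0) (MP 0).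
have key t : a (i0 + t)%N + e * \sum_(i0 <= i < i0 + t) gamma i <=
    a i0 + 2 * (M + m) * \sum_(i0 <= i < i0 + t) gamma i ^+ 2.
  elim: t => [|t ih]; first by rewrite addn0 !big_geq// !mulr0 !addr0.
  rewrite addnS !big_nat_recr ?leq_addr//=.
  set n := (i0 + t)%N in ih *.
  have jn : (j <= n)%N by rewrite (leq_trans _ (leq_addr _ _))// leq_maxl.
  have := ab_rec n.
  have : e * gamma n <= gamma n * b n by rewrite mulrC ler_pM2l// h.
  have : 2 * gamma n ^+ 2 * a n <= 2 * gamma n ^+ 2 * M.
    by rewrite ler_wpM2l// mulr_ge0// sqr_ge0.
  by lra.
have [n nP] := gamma_unbounded ((a i0 + 2 * (M + m)) / e) i0.
have Mm0 : 0 <= 2 * (M + m) by apply: mulr_ge0 => //; exact: addr_ge0.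
have c0 : 0 <= (a i0 + 2 * (M + m)) / e.
  by apply: divr_ge0 (ltW e0); exact: addr_ge0.
have [i0n|/ltnW ni0] := leqP i0 n; last first.
  by move: nP; rewrite (big_geq ni0) ltNge c0.
have := key (n - i0)%N; rewrite (subnKC i0n) => keyn.
move: nP; rewrite ltr_pdivrMr// ltNge => /negP; apply; rewrite mulrC.
apply: (@le_trans _ _ (a n + e * \sum_(i0 <= i < n) gamma i)).
  by rewrite lerDr.
apply: le_trans keyn _; rewrite lerD2l ler_piMr//.
apply: le_trans (j2P n); rewrite [leRHS](big_cat_nat (leq_maxr j j2) i0n) /=.
by rewrite lerDr; apply: sumr_ge0 => i _; exact: sqr_ge0.
Qed.

End descent_recursion.

(** * The natural filtration *)

Section completeness.
Context d (Omega : measurableType d) (R : realType) (P : probability Omega R).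
Hypothesis P_complete : measure_is_complete P.

(** The two preimages of a measurable set differ by a null set. *)
Lemma ae_eq_measurable d' (U : measurableType d') (g h : Omega -> U) :
  measurable_fun setT g -> {ae P, forall w, h w = g w} -> measurable_fun setT h.
Proof.
move=> mg gh _ A mA; rewrite setTI.
pose E := [set w | h w = g w].
have mE : measurable (~` E) by exact: P_complete.
rewrite (_ : h @^-1` A = (g @^-1` A `&` E) `|` (h @^-1` A `&` ~` E)).
  apply: measurableU.
    apply: measurableI; first by rewrite -[X in measurable X]setTI; exact: mg.
    by rewrite -[E]setCK; exact: measurableC.
  apply: P_complete.
  exact: (negligibleS (@subIsetr _ _ _)).
apply/seteqP; split => w /=.
  by move=> hA; have [hg|hg] := pselect (E w); [left; rewrite -hg|right].
by move=> [[]|[]//]; rewrite /E /= => + ->.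
Qed.

End completeness.

Lemma meas_vec_sub (R : realType) (N : nat) d (Omega : measurableType d)
  (G : set (set Omega)) (u : Omega -> 'rV[R]_N) :
  <<s G >> `<=` @measurable _ Omega ->
  meas_vec (u : g_sigma_algebraType G -> 'rV[R]_N) -> meas_vec u.
Proof.
move=> GO mu i _ B mB; rewrite setTI; apply: GO.
by rewrite -[X in <<s _ >> X]setTI; exact: mu.
Qed.

Section filtration.
Context (R : realType) (N : nat) d (Omega : measurableType d).
Variable x : nat -> Omega -> 'rV[R]_N.

Local Notation Ft n := (g_sigma_algebraType (sigma_upto x n)).

Lemma sigma_upto_id n : <<s sigma_upto x n >> = sigma_upto x n.
Proof. by apply: sigma_algebra_id; exact: smallest_sigma_algebra. Qed.

Lemma sigma_upto_measurable n : (forall i, (i <= n)%N -> meas_vec (x i)) ->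
  <<s sigma_upto x n >> `<=` @measurable _ Omega.
Proof.
move=> mx; rewrite sigma_upto_id; apply: smallest_sub.
  exact: sigma_algebra_measurable.
move=> A; rewrite -bigcup_mkord_ord => -[i /= ltin [B mB <-]].
have /measurable_rVP mxi := mx (inord i) (ltn_ord (inord i)).
exact: mxi.
Qed.

Lemma meas_vec_sigma_upto n i : (i <= n)%N -> meas_vec (x i : Ft n -> 'rV[R]_N).
Proof.
move=> lein; apply/measurable_rVP => _ B mB.
rewrite /measurable/= sigma_upto_id.
apply: sub_gen_smallest; rewrite -bigcup_mkord_ord.
by exists i => //; exists B => //; rewrite /= inordK.
Qed.

End filtration.

(** * The projected stochastic iteration *)

Section iteration.
Context (R : realType) (N : nat).
Context d (Omega : measurableType d) (P : probability Omega R).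
Hypothesis P_complete : measure_is_complete P.
Context d' (K : measurableType d') (k : {RV P >-> K}).
Variable Z : K -> set 'rV[R]_N.
Hypothesis hZ : forall kappa, nonempty_closed_convex (Z kappa).
Hypothesis T_meas : measurable_fun [set: K * borelRV R N]
     (fun z : K * borelRV R N => Tfun Z z.1 z.2).
Variable f : 'rV[R]_N -> R.
Hypothesis fE : forall u, (\int[P]_w (Tfun Z (k w) u)%:E = (f u)%:E)%E.
Variable C : set 'rV[R]_N.
Hypothesis hC : nonempty_closed_convex C.
Variable gamma : nat -> R.
Hypothesis gamma_gt0 : forall n, 0 < gamma n.
Variable x : nat -> Omega -> 'rV[R]_N.
Hypothesis x0_meas : meas_vec (x 0).
Variable kn : nat -> {RV P >-> K}.
Hypothesis kn_copy : forall n, is_copy (kn n) k.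
Hypothesis kn_indep : forall n, independent_of (kn n) (sigma_upto x n).
Hypothesis x_rec : forall n, {ae P, forall w,
     x n.+1 w = proj_set C ((1 - gamma n) *: x n w
                        + gamma n *: proj_set (Z (kn n w)) (x n w))}.

Local Notation Ft n := (g_sigma_algebraType (sigma_upto x n)).

Lemma meas_vec_iterate n : meas_vec (x n).
Proof.
elim: n => [|n mxn]; first exact: x0_meas.
have mstep : meas_vec (fun w => proj_set C ((1 - gamma n) *: x n w
    + gamma n *: proj_set (Z (kn n w)) (x n w))).
  apply: (meas_vec_proj hC); apply: meas_vecD; apply: meas_vecZ => //.
  exact: (meas_vec_random_proj hZ T_meas).
move=> i; apply: (ae_eq_measurable P_complete (mstep i)).
by apply: filterS (x_rec n) => w ->.
Qed.

Lemma iterate_in n : {ae P, forall w, C (x n.+1 w)}.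
Proof. by apply: filterS (x_rec n) => w ->; exact: proj_set_in. Qed.

Lemma past_measurable n : <<s sigma_upto x n >> `<=` @measurable _ Omega.
Proof. by apply: sigma_upto_measurable => i _; exact: meas_vec_iterate. Qed.

(** The index of step [n] is independent of the past [x 0, ..., x n], so it can
    be integrated out while the past is fixed; this replaces a conditional
    expectation. *)
Lemma integral_fresh n (A : set Omega) (u : Omega -> 'rV[R]_N) :
  measurable (A : set (Ft n)) -> meas_vec (u : Ft n -> 'rV[R]_N) ->
  (\int[P]_(w in A) (Tfun Z (kn n w) (u w))%:E = \int[P]_(w in A) (f (u w))%:E)%E.
Proof.
move=> mA mu.
pose Phi (z : K * Ft n) : \bar R := (Tfun Z z.1 (u z.2) * \1_A z.2)%:E.
have mPhi : measurable_fun setT Phi.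
  apply/measurable_EFinP; apply: measurable_funM.
    apply: (measurable_Tfun T_meas) => //.
    move=> i; exact: (measurableT_comp (mu i)).
  apply: (measurableT_comp _ (@measurable_snd _ _ K (Ft n))).
  exact: measurable_indic.
have Phi0 z : (0 <= Phi z)%E by rewrite lee_fin mulr_ge0// sqr_ge0.
have G_indep : independent_of (kn n) <<s sigma_upto x n >>.
  by rewrite sigma_upto_id; exact: kn_indep.
have := integral_freezing (@past_measurable n) G_indep mPhi Phi0.
have restrictE (g : Omega -> R) :
    (\int[P]_(w in A) (g w)%:E = \int[P]_w (g w * \1_A w)%:E)%E.
  rewrite integral_mkcond; apply: eq_integral => w _.
  by rewrite patchE indicE; case: (w \in A); rewrite ?mulr1 ?mulr0.
rewrite restrictE => ->; rewrite restrictE; apply: eq_integral => w _.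
rewrite (eq_measure_integral (distribution P k)); last first.
  by move=> B mB _; exact: kn_copy.
rewrite (ge0_integral_distribution k (f := fun kappa => Phi (kappa, w))).
- rewrite /Phi /=; under eq_integral do rewrite mulrC EFinM.
  rewrite ge0_integralZl_EFin//.
  + by rewrite fE -EFinM mulrC.
  + by move=> *; rewrite lee_fin sqr_ge0.
  + apply/measurable_EFinP.
    exact: (measurable_Tfun T_meas (u := fun=> u w)) _ (meas_vec_cst _).
- by apply: (measurableT_comp mPhi); exact: measurable_fun_pair.
- by move=> kappa; exact: Phi0.
Qed.

Lemma step_descent n (z : Omega -> 'rV[R]_N) : (forall w, C (z w)) ->
  {ae P, forall w,
  sqn (x n.+1 w - z w) + gamma n * Tfun Z (kn n w) (x n w) <=
  (1 + 2 * gamma n ^+ 2) * sqn (x n w - z w)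
    + (gamma n + 2 * gamma n ^+ 2) * Tfun Z (kn n w) (z w)}.
Proof.
move=> Cz; apply: filterS (x_rec n) => w ->.
have g0 := ltW (gamma_gt0 n).
apply: le_trans (relaxed_projection_le (hZ (kn n w)) (x n w) (z w) g0).
by rewrite lerD2r; exact: proj_closer.
Qed.

(** The freshness of the index turns the pointwise estimate into an estimate
    on every event of the past; the comparison point may itself be random, as
    long as it depends on the past only. *)
Lemma integral_step n (A : set Omega) (z : Omega -> 'rV[R]_N) :
  measurable (A : set (Ft n)) -> meas_vec (z : Ft n -> 'rV[R]_N) ->
  (forall w, C (z w)) ->
  (\int[P]_(w in A) (sqn (x n.+1 w - z w))%:E
     + (gamma n)%:E * \int[P]_(w in A) (f (x n w))%:E <=
   (1 + 2 * gamma n ^+ 2)%:E * \int[P]_(w in A) (sqn (x n w - z w))%:E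
     + (gamma n + 2 * gamma n ^+ 2)%:E * \int[P]_(w in A) (f (z w))%:E)%E.
Proof.
move=> FA Fz Cz; have mA := past_measurable FA.
have mz := meas_vec_sub (@past_measurable n) Fz.
have Fx : meas_vec (x n : Ft n -> 'rV[R]_N) by exact: meas_vec_sigma_upto.
rewrite -(integral_fresh FA Fz) -(integral_fresh FA Fx).
have g0 := ltW (gamma_gt0 n).
have mV i : measurable_fun setT (fun w => sqn (x i w - z w)).
  by apply: meas_sqn; apply: meas_vecB => //; exact: meas_vec_iterate.
have mTx : measurable_fun setT (fun w => Tfun Z (kn n w) (x n w)).
  by apply: (measurable_Tfun T_meas) => //; exact: meas_vec_iterate.
have mTz : measurable_fun setT (fun w => Tfun Z (kn n w) (z w)).
  exact: (measurable_Tfun T_meas).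
have V0 i w : 0 <= sqn (x i w - z w) by exact: sqn_ge0.
have T0 u w : 0 <= Tfun Z (kn n w) u by exact: sqr_ge0.
have := ge0_integral_comb P mA (mV n.+1) mTx (V0 n.+1)
  (fun w => T0 (x n w) w) ler01 g0 (lexx 0).
rewrite mul1e mul0e adde0 => <-.
have := ge0_integral_le_comb (P := P) (a := 1 + 2 * gamma n ^+ 2)
  (b := gamma n + 2 * gamma n ^+ 2) (c := 0) mA
  (h := fun w => 1 * sqn (x n.+1 w - z w) + gamma n * Tfun Z (kn n w) (x n w) + 0)
  (f := fun w => sqn (x n w - z w)) (g := fun w => Tfun Z (kn n w) (z w)).
rewrite mul0e adde0; apply => //.
- apply: measurable_funD => //; apply: measurable_funD; exact: measurable_funM.
- by move=> w; rewrite mul1r addr0 addr_ge0// mulr_ge0.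
- by rewrite addr_ge0// mulr_ge0// sqr_ge0.
- by rewrite addr_ge0// mulr_ge0// sqr_ge0.
- apply: filterS (step_descent n Cz) => w; rewrite mul1r !addr0; exact: id.
Qed.


End iteration.

(** * Quasi-Fejer sequences: from a descent estimate to convergence *)

(** The iteration enters only through [X_step]. The sequence [X] stands for the
    iterates from time 1 on, because the starting point need not lie in [C] and
    so may have a risk below the minimum over [C]. *)
Section convergence.
Context (R : realType) (N : nat).
Context d (Omega : measurableType d) (P : probability Omega R).
Hypothesis P_complete : measure_is_complete P.
Variables (f : 'rV[R]_N -> R) (C : set 'rV[R]_N).
Hypothesis f_cont : continuous f.
Hypothesis f_convex : forall (t : R) u v, 0 <= t <= 1 ->
  f (t *: u + (1 - t) *: v) <= t * f u + (1 - t) * f v.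
Hypothesis f_ge0 : forall u, 0 <= f u.
Hypothesis hC : nonempty_closed_convex C.
Local Notation S := (argmin C (fun u => (f u)%:E)).
Variable s : 'rV[R]_N.
Hypothesis Ss : S s.

Variable gamma : nat -> R.
Hypothesis gamma_gt0 : forall n, 0 < gamma n.
Hypothesis gamma_unbounded :
  forall B j, exists n, B < \sum_(j <= i < n) gamma i.
Hypothesis gamma2_tails : forall e, 0 < e ->
  exists j, forall n, \sum_(j <= i < n) gamma i ^+ 2 <= e.

Variable G : nat -> set (set Omega).
Local Notation Ft n := (g_sigma_algebraType (G n)).
Hypothesis G_meas : forall n, <<s G n >> `<=` @measurable _ Omega.
Variable X : nat -> Omega -> 'rV[R]_N.
Hypothesis X_adapted : forall n i, (i <= n)%N -> meas_vec (X i : Ft n -> 'rV[R]_N).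
Hypothesis X_in : forall n, {ae P, forall w, C (X n w)}.
Hypothesis X0_int : (\int[P]_w (sqn (X 0 w - s))%:E < +oo)%E.
Hypothesis X_step : forall n (A : set Omega) (z : Omega -> 'rV[R]_N),
  measurable (A : set (Ft n)) -> meas_vec (z : Ft n -> 'rV[R]_N) ->
  (forall w, C (z w)) ->
  (\int[P]_(w in A) (sqn (X n.+1 w - z w))%:E
     + (gamma n)%:E * \int[P]_(w in A) (f (X n w))%:E <=
   (1 + 2 * gamma n ^+ 2)%:E * \int[P]_(w in A) (sqn (X n w - z w))%:E
     + (gamma n + 2 * gamma n ^+ 2)%:E * \int[P]_(w in A) (f (z w))%:E)%E.

Let hS : nonempty_closed_convex S.
Proof. by apply: argmin_nonempty_closed_convex => //; exists s. Qed.

Let m_le v : C v -> f s <= f v.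
Proof. by have /argminP[_] := Ss; apply. Qed.

Let fS v : S v -> f v = f s.
Proof. by move=> Sv; exact: argmin_eq Sv Ss. Qed.

Let SC v : S v -> C v. Proof. by case. Qed.

Let mX n : meas_vec (X n).
Proof. exact: (meas_vec_sub (@G_meas n) (X_adapted (leqnn n))). Qed.

Let mf n : measurable_fun [set: Omega] (fun w => f (X n w)).
Proof. exact: meas_comp_continuous. Qed.

(** For a minimizer the first-order terms have a favourable sign, so the squared
    distance is a supermartingale up to summable errors; the event [A] plays the
    role of conditioning on the past. *)
Lemma step_to_solution n (A : set Omega) (z : Omega -> 'rV[R]_N) :
  measurable (A : set (Ft n)) -> meas_vec (z : Ft n -> 'rV[R]_N) ->
  (forall w, S (z w)) ->
  (\int[P]_(w in A) (sqn (X n.+1 w - z w))%:E <=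
   (1 + 2 * gamma n ^+ 2)%:E * \int[P]_(w in A) (sqn (X n w - z w))%:E
     + (2 * gamma n ^+ 2 * f s)%:E * P A)%E.
Proof.
move=> FA Fz Sz; have mA := G_meas FA.
have := X_step FA Fz (fun w => SC (Sz w)).
have -> : (\int[P]_(w in A) (f (z w))%:E = (f s)%:E * P A)%E.
  by under eq_integral do rewrite (fS (Sz _)); rewrite integral_cst.
have fA : ((f s)%:E * P A <= \int[P]_(w in A) (f (X n w))%:E)%E.
  rewrite -integral_cst//; apply: ae_ge0_le_integral => //.
  - by move=> w _ /=; rewrite lee_fin.
  - by move=> w _ /=; rewrite lee_fin.
  - by apply/measurable_EFinP; apply: measurable_funTS; exact: mf.
  - by apply: filterS (X_in n) => w Cw _ /=; rewrite lee_fin m_le.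
have PA : P A \is a fin_num by rewrite fin_num_measure.
rewrite -(fineK PA) in fA *.
move=> step.
have g0 := ltW (gamma_gt0 n).
rewrite -(@leeD2rE _ ((gamma n)%:E * ((f s)%:E * (fine (P A))%:E)))%E//.
apply: (le_trans (leeD2l _ (lee_wpmul2l _ fA))); first by rewrite lee_fin.
apply: (le_trans step); rewrite -addeA leeD2l// -!EFinM -EFinD lee_fin.
by lra.
Qed.

Definition moment n := fine (\int[P]_w (sqn (X n w - s))%:E)%E.
Definition mean_f n := fine (\int[P]_w (f (X n w))%:E)%E.

Let int_ge0 (g : Omega -> R) : (forall w, 0 <= g w) -> (0 <= \int[P]_w (g w)%:E)%E.
Proof. by move=> g0; apply: integral_ge0 => w _; rewrite lee_fin. Qed.

Lemma momentE n : (\int[P]_w (sqn (X n w - s))%:E = (moment n)%:E)%E.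
Proof.
rewrite /moment fineK// ge0_fin_numE; last by apply: int_ge0 => w; exact: sqn_ge0.
elim: n => [|n ih]; first exact: X0_int.
have step := step_to_solution (n := n) (A := [set: Omega]) measurableT
  (meas_vec_cst s) (fun=> Ss).
apply: le_lt_trans step _.
rewrite [P _](probability_setT P) mule1 lte_add_pinfty ?ltry// lte_mul_pinfty//.
by rewrite lee_fin addr_ge0// mulr_ge0// sqr_ge0.
Qed.

Let moment_step n :
  ((moment n.+1)%:E + (gamma n)%:E * \int[P]_w (f (X n w))%:E <=
   ((1 + 2 * gamma n ^+ 2) * moment n + (gamma n + 2 * gamma n ^+ 2) * f s)%:E)%E.
Proof.
have := X_step (n := n) (A := [set: Omega]) measurableT (meas_vec_cst s)
  (fun=> SC Ss).
by rewrite (integral_prob_cst P) !momentE -!EFinM -EFinD.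
Qed.

Lemma mean_fE n : (\int[P]_w (f (X n w))%:E = (mean_f n)%:E)%E.
Proof.
rewrite /mean_f fineK// ge0_fin_numE; last exact: int_ge0.
rewrite ltey; apply/eqP => foo; have := moment_step n.
by rewrite foo gt0_muley ?lte_fin// addey.
Qed.

Lemma mean_f_ge n : f s <= mean_f n.
Proof.
rewrite -lee_fin -mean_fE -(integral_prob_cst P).
apply: ae_ge0_le_integral => //.
- by move=> w _ /=; rewrite lee_fin.
- by move=> w _ /=; rewrite lee_fin.
- by apply/measurable_EFinP; exact: mf.
- by apply: filterS (X_in n) => w Cw _ /=; rewrite lee_fin m_le.
Qed.

Lemma moment_recursion n :
  moment n.+1 + gamma n * (mean_f n - f s) <=
  (1 + 2 * gamma n ^+ 2) * moment n + 2 * gamma n ^+ 2 * f s.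
Proof.
have := moment_step n; rewrite mean_fE -EFinM -EFinD lee_fin.
by lra.
Qed.

Let moment_ge0 n : 0 <= moment n.
Proof. by rewrite fine_ge0//; apply: int_ge0 => w; exact: sqn_ge0. Qed.

Lemma moment_bounded : exists M, forall n, moment n <= M.
Proof.
apply: (descent_bounded gamma_gt0 gamma2_tails moment_ge0 _ (f_ge0 s)
  moment_recursion).
by move=> n; rewrite subr_ge0 mean_f_ge.
Qed.

Lemma mean_f_small e j : 0 < e -> exists2 n, (j <= n)%N & mean_f n < f s + e.
Proof.
move=> e0; have b0 n : 0 <= mean_f n - f s by rewrite subr_ge0 mean_f_ge.
have [n jn le] := descent_small gamma_gt0 gamma_unbounded gamma2_tails
  moment_ge0 b0 (f_ge0 s) moment_recursion j e0.
by exists n => //; lra.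
Qed.

Let measurable_ltr d0 (T : measurableType d0) (g : T -> R) (c : R) :
  measurable_fun setT g -> measurable [set w | g w < c].
Proof.
move=> mg; rewrite -[X in measurable X]setTI.
rewrite (_ : [set w | _] = g @^-1` `]-oo, c[%classic).
  by apply: mg => //; exact: measurable_itv.
by apply/seteqP; split => w /=; rewrite in_itv.
Qed.

Let measurable_ger d0 (T : measurableType d0) (g : T -> R) (c : R) :
  measurable_fun setT g -> measurable [set w | c <= g w].
Proof.
move=> mg; rewrite (_ : [set w | _] = ~` [set w | g w < c]).
  by apply: measurableC; exact: measurable_ltr.
by apply/seteqP; split => w /=; rewrite leNgt => /negP.
Qed.

(** A point of [C] that is far from the solutions is either far from [s] or has
    a value well above the minimum; both are unlikely when the mean value is
    nearly minimal. *)
Lemma late_near_solutions (dl eta : R) j : 0 < dl -> 0 < eta ->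
  exists2 n, (j <= n)%N &
    (P [set w | (dl <= sqn (X n w - proj_set S (X n w)))%R] <= eta%:E)%E.
Proof.
move=> dl0 eta0; have [M MP] := moment_bounded.
have M0 : 0 <= M := le_trans (moment_ge0 0) (MP 0%N).
(* Both the event that the squared distance to s exceeds r and the event that
   the value exceeds the minimum by e get probability at most eta / 2. *)
pose r := 2 * (M + 1) / eta.
have r0 : 0 < r by apply: divr_gt0 => //; apply: mulr_gt0 => //; lra.
have [e e0 eP] := argmin_gap f_cont f_convex hC r Ss dl0.
have [n jn nP] := mean_f_small j (mulr_gt0 e0 (divr_gt0 eta0 (ltr0n _ 2))).
exists n => //; set A := [set w | _].
have mA : measurable A.
  apply: (measurable_ger (g := fun w => sqn (X n w - proj_set S (X n w)))).
  by apply: meas_sqn; apply: meas_vecB => //; exact: (meas_vec_proj hS).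
have mV : measurable_fun setT (fun w => sqn (X n w - s)).
  by apply: meas_sqn; apply: meas_vecB => //; exact: meas_vec_cst.
have m1 : measurable_fun setT (\1_A : Omega -> R) by exact: measurable_indic.
have ind0 w : 0 <= (\1_A w : R) by rewrite indicE.
have er0 : 0 <= e / r by apply: divr_ge0; exact: ltW.
have := ge0_integral_comb P (A := setT) measurableT m1 (measurable_cst (0 : R))
  ind0 (fun=> lexx 0) (ltW e0) (lexx 0) (f_ge0 s).
rewrite mul0e adde0 integral_indic// setIT.
have := ge0_mean_le_comb (P := P) (a := 1) (b := e / r) (c := 0)
  (h := fun w => e * \1_A w + 0 * 0 + f s) (f := fun w => f (X n w))
  (g := fun w => sqn (X n w - s)).
move=> le1 eq1; move: le1; rewrite eq1 mean_fE momentE mul1e adde0.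
have -> : ((f s)%:E * P setT = (f s)%:E)%E.
  transitivity ((f s)%:E * P [set: Omega])%E => //.
  by rewrite probability_setT mule1.
rewrite -!EFinM -!EFinD => le1.
have {}le1 : (e%:E * P A + (f s)%:E <= (mean_f n + e / r * moment n)%:E)%E.
  apply: le1 => //.
  - by do !apply: measurable_funD => //; exact: measurable_funM.
  - move=> w; rewrite mul0r addr0; apply: addr_ge0 => //.
    by apply: mulr_ge0 => //; exact: ltW.
  - by move=> w; exact: sqn_ge0.
  apply: filterS (X_in n) => w Cw.
  have V0 : 0 <= e / r * sqn (X n w - s) by rewrite mulr_ge0// sqn_ge0.
  have fsw := m_le Cw.
  rewrite indicE mul0r !addr0 mul1r; have [|_] := boolP (w \in A); last first.
    by rewrite mulr0 add0r -[leLHS]addr0 lerD.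
  rewrite inE /A /= mulr1 => farw.
  have [ler|ltr] := leP (sqn (X n w - s)) r.
    have [lefe|ltfe] := leP (f (X n w)) (f s + e).
      by have := eP _ Cw ler lefe; rewrite ltNge farw.
    by lra.
  suff : e <= e / r * sqn (X n w - s) by lra.
  by rewrite -mulrA ler_peMr// ?(ltW e0)// ler_pdivlMl// mulr1 ltW.
have PA : P A \is a fin_num by rewrite fin_num_measure.
move: le1; rewrite -(fineK PA) -EFinM -EFinD !lee_fin => le1.
have : e / r * moment n <= e * (eta / 2).
  rewrite -mulrA ler_pM2l// /r invf_div mulrAC ler_pdivrMr; last by lra.
  by have := ler_wpM2l (ltW eta0) (MP n); lra.
move=> le2; have : e * fine (P A) <= e * eta by lra.
by rewrite ler_pM2l.
Qed.

Section maximal_inequality.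
Variables (j : nat) (z : Omega -> 'rV[R]_N) (dl c tau : R).
Hypothesis Sz : forall w, S (z w).
Hypothesis dl_gt0 : 0 < dl.
Hypothesis dlc : dl <= c.
Hypothesis tauP : forall n, \sum_(j <= i < n) gamma i ^+ 2 <= tau.
Hypothesis z_past : forall n, (j <= n)%N -> meas_vec (z : Ft n -> 'rV[R]_N).

Let V n w := sqn (X n w - z w).

(** The event that [X] has stayed close to [z] from time [j] to [j + t]. *)
Let close := fix close t : set Omega :=
  if t is t'.+1 then close t' `&` [set w | V (j + t'.+1) w < c]
  else [set w | V j w < dl].

Let measurable_close t n : (j + t <= n)%N -> measurable (close t : set (Ft n)).
Proof.
have mV i m : (j <= m)%N -> (i <= m)%N ->
    measurable_fun setT (V i : Ft m -> R).
  move=> jm im; apply: meas_sqn; apply: meas_vecB; first exact: X_adapted.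
  exact: z_past.
elim: t n => [|t ih] n jtn.
  rewrite addn0 in jtn.
  by apply: (measurable_ltr (T := Ft n)); exact: mV.
apply: measurableI.
  by apply: ih; rewrite (leq_trans _ jtn)// leq_add2l.
apply: (measurable_ltr (T := Ft n)); apply: mV => //.
exact: leq_trans (leq_addr _ _) jtn.
Qed.

Let measurable_closeT t : measurable (close t).
Proof. exact: (G_meas (measurable_close (leqnn (j + t)))). Qed.

Let close_lt t w : close t w -> V (j + t) w < c.
Proof.
case: t => [|t] /=; last by case.
by rewrite addn0 => /lt_le_trans; apply.
Qed.

Let mV n : measurable_fun setT (V n).
Proof.
apply: meas_sqn; apply: meas_vecB => //.
exact: (meas_vec_sub (@G_meas j) (z_past (leqnn j))).
Qed.

Let V_ge0 n w : 0 <= V n w.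
Proof. exact: sqn_ge0. Qed.

Let c_gt0 : 0 < c.
Proof. exact: lt_le_trans dl_gt0 dlc. Qed.

Let mEV n (A : set Omega) : measurable_fun A (fun w => (V n w)%:E).
Proof. by apply/measurable_EFinP; exact: measurable_funTS. Qed.

Let int_close_le t : (\int[P]_(w in close t) (V (j + t) w)%:E <= c%:E)%E.
Proof.
apply: (@le_trans _ _ (\int[P]_(w in close t) c%:E)%E).
  apply: ge0_le_integral => //.
  - by move=> w _; rewrite lee_fin.
  - by move=> w /close_lt/ltW; rewrite lee_fin.
rewrite integral_cst// -[leRHS]mule1; apply: lee_wpmul2l.
  by rewrite lee_fin ltW.
exact: probability_le1.
Qed.

(** The mean of the squared distance stopped, with value [c], at the first time
    it reaches [c]. *)
Let stopped t : \bar R :=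
  (\int[P]_(w in close t) (V (j + t) w)%:E + c%:E * P (~` close t))%E.

Let stopped_le t : (stopped t.+1 <=
  \int[P]_(w in close t) (V (j + t.+1) w)%:E + c%:E * P (~` close t))%E.
Proof.
pose D := close t `\` close t.+1.
have mD : measurable D by exact: measurableD.
have sub : close t.+1 `<=` close t by move=> w [].
have PE : P (~` close t.+1) = (P D + P (~` close t))%E.
  rewrite -measureU//; last 2 first.
  - exact: measurableC.
  - by apply/seteqP; split => // w [[]].
  congr (P _); apply/seteqP; split => w.
    move=> nw; have [ct|nct] := pselect (close t w); [by left|by right].
  by move=> [[]//|nct /sub].
have IE : (\int[P]_(w in close t) (V (j + t.+1) w)%:E =
    \int[P]_(w in close t.+1) (V (j + t.+1) w)%:E
    + \int[P]_(w in D) (V (j + t.+1) w)%:E)%E.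
  rewrite -ge0_integral_setU//.
  - congr (integral _ _ _); apply/seteqP; split => w.
      move=> ct; have [c1|c1] := pselect (close t.+1 w); [by left|by right].
    by move=> [/sub//|[]].
  - by move=> w _; rewrite lee_fin.
  - by apply/disj_setPRL => w [].
rewrite /stopped PE IE ge0_muleDr// -addeA leeD2l// leeD2r//.
rewrite -integral_cst//; apply: ge0_le_integral => //.
- by move=> w _; rewrite lee_fin ltW.
- by move=> w [ct nc]; rewrite lee_fin leNgt; apply/negP => ltc; apply: nc.
Qed.

Let stopped_bound t : (stopped t <= c%:E * P [set w | (dl <= V j w)%R] + dl%:E
  + (2 * (c + f s) * \sum_(j <= i < j + t) gamma i ^+ 2)%:E)%E.
Proof.
elim: t => [|t ih].
  rewrite addn0 big_geq// mulr0 adde0 /stopped addn0 addeC.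
  apply: leeD.
    rewrite (_ : ~` _ = [set w | dl <= V j w])//.
    by apply/seteqP; split => w /=; rewrite leNgt => /negP.
  apply: (@le_trans _ _ (\int[P]_(w in close 0) dl%:E)%E).
    apply: ge0_le_integral => //.
    - by move=> w _; rewrite lee_fin.
    - by move=> w /= /ltW; rewrite lee_fin.
  rewrite integral_cst// -[leRHS]mule1; apply: lee_wpmul2l.
    by rewrite lee_fin ltW.
  exact: probability_le1.
apply: le_trans (stopped_le t) _.
have := step_to_solution (measurable_close (leqnn (j + t)))
  (z_past (leq_addr t j)) Sz.
rewrite -addnS => step.
have := leeD2r (c%:E * P (~` close t))%E step => {}step.
apply: le_trans step _.
rewrite addnS big_nat_recr ?leq_addr//= (mulrDr (2 * (c + f s))).
rewrite [(2 * (c + f s) * _ + _)%:E]EFinD [leRHS]addeA.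
apply: le_trans _ (leeD2r _ ih).
rewrite /stopped.
have g2 : 0 <= gamma (j + t) ^+ 2 by exact: sqr_ge0.
have I0 : (0 <= \int[P]_(w in close t) (V (j + t) w)%:E)%E.
  by apply: integral_ge0 => w _; rewrite lee_fin.
have Ifin : (\int[P]_(w in close t) (V (j + t) w)%:E \is a fin_num)%E.
  by rewrite ge0_fin_numE//; apply: le_lt_trans (int_close_le t) _; rewrite ltry.
have PA : P (close t) \is a fin_num by rewrite fin_num_measure.
have PC : P (~` close t) \is a fin_num.
  by rewrite fin_num_measure//; exact: measurableC.
have PA1 : (P (close t) <= 1)%E by exact: probability_le1.
have Ic := int_close_le t.
move: Ic I0 PA1.
rewrite -(fineK Ifin) -(fineK PA) -(fineK PC) -!EFinM -!EFinD !lee_fin.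
move: (fine _) (fine (P (close t))) (fine (P (~` close t))) => I p q Ic I0 p1.
have : 2 * gamma (j + t) ^+ 2 * I <= 2 * gamma (j + t) ^+ 2 * c.
  by rewrite ler_wpM2l// mulr_ge0.
have : 2 * gamma (j + t) ^+ 2 * f s * p <= 2 * gamma (j + t) ^+ 2 * f s * 1.
  by rewrite ler_wpM2l// mulr_ge0// mulr_ge0.
by lra.
Qed.

(** A stopped supermartingale argument: while [X] stays close to [z] the step
    estimate applies on the event [close t], and on the first exit the stopped
    value [c] is dominated by the actual squared distance. *)
Lemma maximal_inequality : exists2 B : set Omega, measurable B &
  (c%:E * P B <= c%:E * P [set w | (dl <= V j w)%R] + dl%:E
     + (2 * (c + f s) * tau)%:E)%E /\
  forall w, ~ B w -> forall n, (j <= n)%N -> sqn (X n w - z w) < c.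
Proof.
pose B := \bigcup_t (~` close t).
have mB : measurable B by apply: bigcupT_measurable => t; exact: measurableC.
exists B => //; split; last first.
  move=> w nBw n jn; rewrite -(subnKC jn); apply: close_lt.
  by apply: contrapT => nc; apply: nBw; exists (n - j)%N.
have cvB : P (~` close t) @[t --> \oo] --> P B.
  apply: nondecreasing_cvg_mu => //.
    by move=> t; exact: measurableC.
  apply/nondecreasing_seqP => t; apply/subsetPset => w nc.
  by move=> [].
have bnd t : (P (~` close t) <= c^-1%:E * (c%:E * P [set w | (dl <= V j w)%R] + dl%:E
     + (2 * (c + f s) * tau)%:E))%E.
  rewrite lee_pdivlMl//; apply: (@le_trans _ _ (stopped t)).
    rewrite /stopped leeDr// integral_ge0// => w _.
    by rewrite lee_fin.
  apply: (le_trans (stopped_bound t)); rewrite leeD2l// lee_fin ler_wpM2l//.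
  by rewrite mulr_ge0// addr_ge0// ltW.
rewrite -lee_pdivlMl// -(cvg_lim _ cvB)//; apply: lime_le.
  by apply/cvg_ex; exists (P B).
exact: nearW.
Qed.

End maximal_inequality.

(** The maximal inequality, started at a late time given by
    [late_near_solutions] with the projection of that iterate onto the solutions
    as the centre. *)
Lemma tail_near_solution (c eta : R) : 0 < c -> 0 < eta ->
  exists j (z : Omega -> 'rV[R]_N) (B : set Omega),
    [/\ measurable B, (P B <= eta%:E)%E, forall w, S (z w) &
      forall w, ~ B w -> forall n, (j <= n)%N -> sqn (X n w - z w) < c].
Proof.
move=> c0 eta0; have cf0 : 0 < c + f s by rewrite ltr_wpDr.
(* The bound c * eta of the maximal inequality is shared equally by the event
   that X starts far from z, by its initial distance and by the noise. *)
pose tau := eta * c / (6 * (c + f s)).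
have tau0 : 0 < tau by apply: divr_gt0; apply: mulr_gt0.
have [j0 j0P] := gamma2_tails tau0.
pose dl := Num.min c (eta * c / 3).
have dl0 : 0 < dl by rewrite lt_min c0 divr_gt0// mulr_gt0.
have dlc : dl <= c by rewrite ge_min lexx.
have dl3 : dl <= eta * c / 3 by rewrite ge_min lexx orbT.
have [j j0j jP] := late_near_solutions j0 dl0 (divr_gt0 eta0 (ltr0n _ 3)).
have tails n : \sum_(j <= i < n) gamma i ^+ 2 <= tau.
  have [jn|/ltnW nj] := leqP j n; last by rewrite big_geq// ltW.
  apply: le_trans (j0P n); rewrite [leRHS](big_cat_nat j0j jn) /= lerDr.
  by apply: sumr_ge0 => i _; exact: sqr_ge0.
pose z w := proj_set S (X j w).
have Sz w : S (z w) by exact: proj_set_in.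
have z_past n : (j <= n)%N -> meas_vec (z : Ft n -> 'rV[R]_N).
  by move=> jn; apply: (meas_vec_proj hS); exact: X_adapted.
have [B mB [PB BP]] := maximal_inequality Sz dl0 dlc tails z_past.
exists j, z, B; split => //.
have PBfin : P B \is a fin_num by rewrite fin_num_measure.
have {}PB : (c%:E * P B <= c%:E * (eta / 3)%:E + dl%:E
    + (2 * (c + f s) * tau)%:E)%E.
  apply: (le_trans PB); rewrite leeD2r// leeD2r// lee_wpmul2l//.
  by rewrite lee_fin ltW.
move: PB; rewrite -(fineK PBfin) -!EFinM -!EFinD !lee_fin => PB.
have tauE : 2 * (c + f s) * tau = eta * c / 3.
  by rewrite /tau; field; rewrite gt_eqF.
by rewrite -(ler_pM2l c0); lra.
Qed.

Lemma small_cover_negligible (A : set Omega) :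
  (forall eta : R, 0 < eta ->
    exists B, [/\ measurable B, A `<=` B & (P B <= eta%:E)%E]) ->
  P.-negligible A.
Proof.
move=> AP; have e0 n : 0 < n.+1%:R^-1 :> R by rewrite invr_gt0.
have /choice[B BP] : forall n, exists B,
    [/\ measurable B, A `<=` B & (P B <= (n.+1%:R^-1)%:E)%E].
  by move=> n; exact: AP.
have mB n : measurable (B n) by have [] := BP n.
exists (\bigcap_n B n); split.
- by apply: bigcapT_measurable.
- apply/eqP; rewrite eq_le measure_ge0 andbT; apply/lee_addgt0Pr => e e0'.
  rewrite add0e.
  have [n _ /(_ n (leqnn n)) /ltW ne] := near_infty_natSinv_lt (PosNum e0').
  have [_ _ Bn] := BP n.
  apply: le_trans (le_trans Bn _); last by rewrite lee_fin.
  apply: le_measure; rewrite ?inE//; first exact: bigcapT_measurable.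
  by move=> w; apply.
- by move=> w Aw n _; have [_ AB _] := BP n; exact: AB.
Qed.

(** The Cauchy property with centres among the solutions, so that the limit is
    a solution as well. *)
Definition tail_close w : Prop := forall c : R, 0 < c ->
  exists j v, S v /\ forall n, (j <= n)%N -> sqn (X n w - v) < c.

Lemma ae_tail_close : {ae P, forall w, tail_close w}.
Proof.
pose A (l : nat) := [set w | ~ exists j v, S v /\
  forall n, (j <= n)%N -> sqn (X n w - v) < l.+1%:R^-1].
have Aneg l : P.-negligible (A l).
  apply: small_cover_negligible => eta eta0.
  have l0 : 0 < l.+1%:R^-1 :> R by rewrite invr_gt0.
  have [j [z [B [mB PB Sz BP]]]] := tail_near_solution l0 eta0.
  exists B; split => // w Aw; apply: contrapT => /BP nBw; apply: Aw.
  by exists j, (z w).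
apply: negligibleS (negligible_bigcup Aneg) => w /= nclose.
apply: contrapT => nA; apply: nclose => c c0.
have [l _ /(_ l (leqnn l)) lc] := near_infty_natSinv_lt (PosNum c0).
have : ~ A l w by move=> Al; apply: nA; exists l.
move=> /contrapT[j [v [Sv vP]]]; exists j, v; split => // n /vP ltl.
exact: lt_trans ltl lc.
Qed.

Lemma tail_close_cvg w : tail_close w -> exists2 v, S v & X n w @[n --> \oo] --> v.
Proof.
move=> cw.
have cauchyX : cauchy (X n w @[n --> \oo]).
  apply/cauchy_exP => e e0.
  have [j [v [Sv vP]]] := cw (e ^+ 2) (exprn_gt0 2 e0).
  exists v; exists j => // n /= /vP ltv.
  rewrite -ball_normE /= distrC; apply: le_lt_trans (normr_le_enorm _) _.
  by rewrite -(@ltr_pXn2r _ 2)// ?nnegrE ?enorm_ge0 ?(ltW e0)// sqr_enorm.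
have cvX : cvgn (fun n => X n w) by exact: cauchy_cvg.
set l := limn (fun n => X n w) in cvX.
have dist0 : dist_set S l ^+ 2 <= 0.
  apply/ler_addgt0Pr => c c0; rewrite add0r.
  have [j [v [Sv vP]]] := cw c c0.
  apply: le_trans (dist_set_le hS l Sv) _.
  have cvV : sqn (X n w - v) @[n --> \oo] --> sqn (l - v).
    exact: (cvg_comp _ _ cvX (@sqn_dist_continuous _ _ v l)).
  apply: (cvgr_to_le cvV).
  by exists j => // n /= /vP /ltW.
exists l => //.
suff -> : l = proj_set S l by exact: proj_set_in.
have := sqn_proj hS l; set p := proj_set S l => /esym lp.
apply/rowP => i; apply/eqP; rewrite -subr_eq0 -sqrf_eq0 eq_le sqr_ge0 andbT.
apply: le_trans dist0; rewrite lp.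
by have := coord_sqn (l - p) i; rewrite !mxE.
Qed.

(** The auxiliary sequence [X'] is [X] frozen at [s] on the exceptional set; it
    converges everywhere, which makes the limit measurable. *)
Lemma exists_limit : exists (y : Omega -> 'rV[R]_N) (X' : nat -> Omega -> 'rV[R]_N),
  [/\ forall w, S (y w), forall w, tail_close w -> X n w @[n --> \oo] --> y w,
    forall n, meas_vec (X' n), forall n w, sqn (X' n w - s) <= sqn (X n w - s) &
    forall w, X' n w @[n --> \oo] --> y w].
Proof.
have /choice[y yP] : forall w, exists v, [/\ S v,
    tail_close w -> X n w @[n --> \oo] --> v & ~ tail_close w -> v = s].
  move=> w; have [cw|ncw] := pselect (tail_close w); last by exists s; split.
  by have [v Sv vP] := tail_close_cvg cw; exists v; split.
pose E := [set w | tail_close w].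
have mE : measurable E.
  rewrite -[E]setCK; apply: measurableC.
  exact: (P_complete ae_tail_close).
pose X' n w := s + (\1_E w : R) *: (X n w - s).
exists y, X'; split.
- by move=> w; have [] := yP w.
- by move=> w; have [] := yP w.
- move=> n i; rewrite /X'; under eq_fun do rewrite mxE mxE.
  apply: measurable_funD; first exact: measurable_cst.
  apply: measurable_funM; first exact: measurable_indic.
  exact: (meas_vecB (mX n) (meas_vec_cst s) i).
- move=> n w; rewrite /X' addrAC subrr add0r indicE.
  by case: (w \in E); rewrite ?scale1r// scale0r sqn0 sqn_ge0.
- move=> w; have [_ yc yn] := yP w; rewrite /X' indicE.
  have [wE|wE] := boolP (w \in E).
    under eq_fun do rewrite scale1r subrKC.
    by apply: yc; rewrite inE in wE.
  under eq_fun do rewrite scale0r addr0.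
  rewrite yn; first exact: cvg_cst.
  by move: wE; rewrite notin_setE.
Qed.

Let Lnorm1_enorm (u : Omega -> 'rV[R]_N) :
  ('N[P]_1%:E[(fun w => (enorm (u w))%:E)] = \int[P]_w (enorm (u w))%:E)%E.
Proof.
rewrite Lnorm1; apply: eq_integral => w _.
by rewrite abse_EFin ger0_norm// enorm_ge0.
Qed.

Lemma in_L1_of_moment (u : Omega -> 'rV[R]_N) : meas_vec u ->
  (\int[P]_w (sqn (u w - s))%:E < +oo)%E ->
  in_Lp P 1 u.
Proof.
move=> mu uoo; split; first exact/measurable_rVP.
rewrite Lnorm1_enorm.
have mV : measurable_fun setT (fun w => sqn (u w - s)).
  by apply: meas_sqn; apply: meas_vecB => //; exact: meas_vec_cst.
have := ge0_mean_le_comb (P := P) (a := 2) (b := 0) (c := 1 + 2 * sqn s)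
  (meas_enorm mu) mV (measurable_cst (0 : R)) (fun w => enorm_ge0 (u w))
  (fun w => sqn_ge0 (u w - s)) (fun=> lexx 0) (ler0n _ 2) (lexx 0).
move=> /(_ _ _)/le_lt_trans; apply.
- by rewrite addr_ge0// mulr_ge0// sqn_ge0.
- apply: nearW => w; have := sqnD_le (u w - s) s; rewrite subrK -sqr_enorm mul0r.
  by have := sqr_ge0 (enorm (u w) - 1); have := sqr_ge0 (enorm (u w)); lra.
- by rewrite mul0e adde0 lte_add_pinfty ?ltry// lte_mul_pinfty.
Qed.

(** The error is small off an event of small probability by
    [tail_near_solution]; on that event it is controlled by the bounded second
    moments, through [t <= r + t ^+ 2 / r]. *)
Lemma iterates_converge : exists y : Omega -> 'rV[R]_N,
  [/\ random_vector y, forall w, S (y w),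
    {ae P, forall w, X n w @[n --> \oo] --> y w} & cvg_Lp P 1 X y].
Proof.
have [y [X' [Sy yP mX' leX' yP']]] := exists_limit.
have my : meas_vec y.
  move=> i; apply: (measurable_fun_cvg (h := fun n w => X' n w ord0 i)) => [n|w _].
    exact: mX'.
  exact: (cvg_comp _ _ (yP' w) (@coord_continuous R 1 N ord0 i (y w))).
have mV (u : Omega -> 'rV[R]_N) : meas_vec u ->
    measurable_fun setT (fun w => sqn (u w - s)).
  by move=> mu; apply: meas_sqn; apply: meas_vecB => //; exact: meas_vec_cst.
have [M MP] := moment_bounded.
(* The second moment passes to the limit by Fatou's lemma. *)
have yM : (\int[P]_w (sqn (y w - s))%:E <= M%:E)%E.
  have X'M n : (\int[P]_w (sqn (X' n w - s))%:E <= M%:E)%E.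
    apply: (@le_trans _ _ (\int[P]_w (sqn (X n w - s))%:E)%E).
      apply: ge0_le_integral => //.
      - by move=> w _; rewrite lee_fin sqn_ge0.
      - by apply/measurable_EFinP; exact: mV.
      - by apply/measurable_EFinP; exact: mV.
      - by move=> w _; rewrite lee_fin.
    by rewrite momentE lee_fin.
  have := fatou P measurableT (f := fun n w => (sqn (X' n w - s))%:E).
  move=> /(_ _ _)/le_trans fat.
  rewrite (eq_integral
    (fun w => limn_einf (fun n => (sqn (X' n w - s))%:E))); last first.
    move=> w _.
    have cvV : (sqn (X' n w - s))%:E @[n --> \oo] --> (sqn (y w - s))%:E.
      apply: cvg_EFin; first exact: nearW.
      exact: (cvg_comp _ _ (yP' w) (@sqn_dist_continuous _ _ s (y w))).
    by have [-> _] := cvg_limn_einf_sup cvV.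
  apply: fat.
  - by move=> n; apply/measurable_EFinP; exact: mV.
  - by move=> n w _; rewrite lee_fin sqn_ge0.
  rewrite limn_einf_lim; apply: lime_le; first exact: is_cvg_einfs.
  apply: nearW => n; apply: le_trans (X'M n); apply: ereal_inf_lbound.
  by exists n => /=.
have Xint n : (\int[P]_w (sqn (X n w - s))%:E <= M%:E)%E.
  by rewrite momentE lee_fin.
have ycvg : {ae P, forall w, X n w @[n --> \oo] --> y w}.
  by apply: filterS ae_tail_close => w; exact: yP.
exists y; split => //; first exact/measurable_rVP.
split=> [n||].
- by apply: in_L1_of_moment => //; apply: le_lt_trans (Xint n) _; rewrite ltry.
- by apply: in_L1_of_moment => //; apply: le_lt_trans yM _; rewrite ltry.
have M0 : 0 <= M := le_trans (moment_ge0 0) (MP 0%N).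
have small e : 0 < e -> \forall n \near \oo,
    (\int[P]_w (enorm (X n w - y w))%:E <= e%:E)%E.
  (* The three parts of the bound, e / 3 off B, r times the probability of B and
     4 M / r, are each at most e / 3. *)
  move=> e0; pose r := 12 * (M + 1) / e.
  have r0 : 0 < r by apply: divr_gt0 => //; apply: mulr_gt0 => //; lra.
  have eta0 : 0 < e / (3 * r) by apply: divr_gt0 => //; exact: mulr_gt0.
  have c0 : 0 < e ^+ 2 / 36 by apply: divr_gt0 => //; exact: exprn_gt0.
  have [j [z [B [mB PB _ BP]]]] := tail_near_solution c0 eta0.
  exists j => // n /= jn.
  have mXy : meas_vec (fun w => X n w - y w) by exact: meas_vecB.
  have mW : measurable_fun setT (fun w => sqn (X n w - s) + sqn (y w - s)).
    by apply: measurable_funD; exact: mV.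
  have m1 : measurable_fun setT (\1_B : Omega -> R) by exact: measurable_indic.
  have ind0 w : 0 <= (\1_B w : R) by rewrite indicE.
  have W0 w : 0 <= sqn (X n w - s) + sqn (y w - s).
    by apply: addr_ge0; exact: sqn_ge0.
  have r2 : 0 <= 2 / r by apply: divr_ge0 => //; exact: ltW.
  have e3 : 0 <= e / 3 by apply: divr_ge0 => //; exact: ltW.
  have := ge0_mean_le_comb (P := P) (meas_enorm mXy) m1 mW
    (fun w => enorm_ge0 _) ind0 W0 (ltW r0) r2 e3.
  move=> /(_ _)/le_trans; apply.
    apply: filterS ycvg => w yw.
    have lesq : sqn (X n w - y w) <= 2 * (sqn (X n w - s) + sqn (y w - s)).
      have := sqnD_le (X n w - s) (s - y w); rewrite (sqnC s) addrA subrK.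
      by rewrite mulrDr.
    have sq0 := sqn_ge0 (X n w - y w).
    rewrite indicE; have [wB|wB] := boolP (w \in B).
      rewrite mulr1; apply: (@le_trans _ _ (r + sqn (X n w - y w) / r)).
        rewrite -(ler_pM2r r0) mulrDl divfK ?gt_eqF// -sqr_enorm.
        have := sqr_ge0 (enorm (X n w - y w) - r); have := enorm_ge0 (X n w - y w).
        have := sqr_ge0 (enorm (X n w - y w)); have := sqr_ge0 r.
        by lra.
      rewrite -[leLHS]addr0 lerD// lerD2l mulrAC ler_pM2r ?invr_gt0//.
    have {}BP := BP w (fun Bw => negP wB (mem_set Bw)).
    rewrite mulr0 add0r; apply: (@le_trans _ _ (e / 3)); last first.
      by rewrite lerDr mulr_ge0.
    rewrite -(@ler_pXn2r _ 2)// ?nnegrE ?enorm_ge0// sqr_enorm.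
    have yz : sqn (y w - z w) <= e ^+ 2 / 36.
      have cvV : sqn (X i w - z w) @[i --> \oo] --> sqn (y w - z w).
        exact: (cvg_comp _ _ yw (@sqn_dist_continuous _ _ (z w) (y w))).
      by apply: (cvgr_to_le cvV); exists j => // i /= /BP /ltW.
    have := sqnD_le (X n w - z w) (z w - y w); rewrite (sqnC (z w)) addrA subrK.
    by have := BP n jn; rewrite exprMn; lra.
  rewrite integral_indic// setIT.
  have WM : (\int[P]_w (sqn (X n w - s) + sqn (y w - s))%:E <= (M + M)%:E)%E.
    under eq_integral do rewrite EFinD.
    rewrite ge0_integralD//.
    - by rewrite EFinD leeD.
    - by move=> w _; rewrite lee_fin sqn_ge0.
    - by apply/measurable_EFinP; exact: mV.
    - by move=> w _; rewrite lee_fin sqn_ge0.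
    - by apply/measurable_EFinP; exact: mV.
  have r00 : (0 <= r%:E)%E by rewrite lee_fin ltW.
  have := lee_wpmul2l r00 PB.
  have := @lee_wpmul2l _ (2 / r)%:E r2 _ _ WM.
  rewrite -!EFinM => le1 le2.
  apply: (le_trans (leeD2r _ (leeD le2 le1))).
  rewrite -!EFinD lee_fin.
  have -> : r * (e / (3 * r)) = e / 3 by field; rewrite gt_eqF.
  have : 2 / r * (M + M) <= e / 3.
    rewrite /r invf_div; rewrite mulrA mulrAC ler_pdivrMr; last by lra.
    by nra.
  by lra.
have fint n e : (\int[P]_w (enorm (X n w - y w))%:E <= e%:E)%E ->
    (\int[P]_w (enorm (X n w - y w))%:E \is a fin_num)%E.
  move=> lee; rewrite ge0_fin_numE; last by apply: int_ge0 => w; exact: enorm_ge0.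
  by apply: le_lt_trans lee _; rewrite ltry.
under eq_fun do rewrite Lnorm1_enorm.
apply/fine_cvgP; split; first by apply: filterS (small 1 ltr01) => n /fint.
apply/cvgrPdist_le => /= e /small; apply: filterS => n lee.
move: (lee); rewrite -(fineK (fint n e lee)) lee_fin sub0r normrN ger0_norm//.
by rewrite /= fine_ge0//; apply: int_ge0 => w; exact: enorm_ge0.
Qed.

End convergence.

(** * Almost sure and mean convergence of the stochastic projection method *)

Theorem proposition5p2 (R : realType) (N : nat)
  (d : measure_display) (Omega : measurableType d) (P : probability Omega R)
  (P_complete : measure_is_complete P)
  (d' : measure_display) (K : measurableType d') (k : {RV P >-> K})
  (C : set 'rV[R]_N) (hC : nonempty_closed_convex C)
  (Z : K -> set 'rV[R]_N) (hZ : forall kappa, nonempty_closed_convex (Z kappa))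
  (T_meas : measurable_fun [set: K * borelRV R N]
     (fun z : K * borelRV R N => Tfun Z z.1 z.2))
  (T0_int : ('E_P[(fun w => Tfun Z (k w) 0%R)] < +oo)%E)
  (argminT : argmin [set: 'rV[R]_N] (fun x => 'E_P[(fun w => Tfun Z (k w) x)]%E)
     !=set0)
  (sol_neq0 : solutions k Z C !=set0)
  (gamma : nat -> R) (gamma_gt0 : forall n, 0 < gamma n)
  (sum_gamma : (\sum_(0 <= n <oo) (gamma n)%:E = +oo)%E)
  (sum_gamma2 : (\sum_(0 <= n <oo) (gamma n ^+ 2)%:E < +oo)%E)
  (x : nat -> Omega -> 'rV[R]_N) (x0_L2 : in_Lp P 2 (x 0%N))
  (kn : nat -> {RV P >-> K})
  (kn_copy : forall n, is_copy (kn n) k)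
  (kn_indep : forall n, independent_of (kn n) (sigma_upto x n))
  (x_rec : forall n, {ae P, forall w,
     x n.+1 w = proj_set C ((1 - gamma n) *: x n w
                        + gamma n *: proj_set (Z (kn n w)) (x n w))}) :
  exists y : Omega -> 'rV[R]_N,
    [/\ random_vector y,
        forall w, solutions k Z C (y w),
        {ae P, forall w, x n w @[n --> \oo] --> y w} &
        cvg_Lp P 1 x y].
Proof.
have fE := riskE hZ T_meas T0_int.
have f_cont := risk_continuous hZ T_meas T0_int.
have f_convex := risk_convex hZ T_meas T0_int.
have f_ge0 := risk_ge0 hZ T_meas T0_int.
have solE := solutionsE hZ T_meas T0_int C.
rewrite solE in sol_neq0 *; clear solE T0_int argminT.
set f := risk k Z in fE f_cont f_convex f_ge0 sol_neq0 *.
have unbounded B j := partial_sums_unbounded B j gamma_gt0 sum_gamma.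
have tails e := @small_tails R _ e (fun n => sqr_ge0 (gamma n)) sum_gamma2.
clear sum_gamma sum_gamma2.
have [s Ss] := sol_neq0.
have [x0_meas x0_norm] := x0_L2.
have mx0 : meas_vec (x 0) by exact/measurable_rVP.
have mx := meas_vec_iterate P_complete hZ T_meas hC mx0 x_rec.
have step := integral_step P_complete hZ T_meas fE hC gamma_gt0 mx0
  kn_copy kn_indep x_rec.
have x_in := iterate_in hC x_rec.
have mV n : measurable_fun setT (fun w => sqn (x n w - s)).
  by apply: meas_sqn; apply: meas_vecB; [exact: mx|exact: meas_vec_cst].
have x0_int : (\int[P]_w (sqn (x 0%N w - s))%:E < +oo)%E.
  have x0_sqn : (\int[P]_w (sqn (x 0%N w))%:E < +oo)%E.
    rewrite (eq_integral (fun w => `|(enorm (x 0%N w))%:E| `^ 2)%E).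
      by rewrite -poweR_Lnorm//; exact: poweR_lty.
    move=> w _; rewrite abse_EFin ger0_norm ?enorm_ge0// poweR_EFin.
    by rewrite powR_mulrn ?enorm_ge0// sqr_enorm.
  have := ge0_mean_le_comb (P := P) (a := 2) (b := 0)
    (c := 2 * sqn s) (mV 0%N) (meas_sqn mx0) (measurable_cst (0 : R))
    (fun w => sqn_ge0 _) (fun w => sqn_ge0 (x 0%N w)) (fun=> lexx 0)
    (ler0n _ 2) (lexx 0).
  move=> /(_ _ _)/le_lt_trans; apply.
  - by rewrite mulr_ge0// sqn_ge0.
  - apply: nearW => w; have := sqnD_le (x 0%N w) (- s).
    rewrite (_ : sqn (- s) = sqn s) ?mul0r ?addr0//.
    by rewrite -[- s]sub0r sqnC subr0.
  - by rewrite mul0e adde0 lte_add_pinfty ?ltry// lte_mul_pinfty.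
have x1_int : (\int[P]_w (sqn (x 1%N w - s))%:E < +oo)%E.
  have := step 0%N [set: Omega] (fun=> s) measurableT (meas_vec_cst s)
    (fun=> (Ss.1 : C s)).
  rewrite (integral_prob_cst P) => step0.
  apply: le_lt_trans (le_trans (leeDl _ _) step0) _.
    rewrite mule_ge0 ?lee_fin ?(ltW (gamma_gt0 0%N))//.
    by apply: integral_ge0 => w _; rewrite lee_fin.
  rewrite lte_add_pinfty// ?ltry// lte_mul_pinfty// lee_fin.
  by rewrite addr_ge0// mulr_ge0// sqr_ge0.
have unbounded1 B j : exists n, B < \sum_(j <= i < n) gamma i.+1.
  by have [n] := unbounded B j.+1; rewrite big_add1; exists n.-1.
have tails1 e : 0 < e -> exists j, forall n, \sum_(j <= i < n) gamma i.+1 ^+ 2 <= e.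
  move=> /tails[j jP]; exists j => n; apply: le_trans (jP n.+1).
  have [jn|/ltnW nj] := leqP j n; last first.
    by rewrite (big_geq nj); apply: sumr_ge0 => i _; exact: sqr_ge0.
  rewrite [leRHS](big_nat_recl _ _ _ jn) /= lerDr; exact: sqr_ge0.
have past := past_measurable P_complete hZ T_meas hC mx0 x_rec.
have adapted n i : (i <= n)%N ->
    meas_vec (x i.+1 : g_sigma_algebraType (sigma_upto x n.+1) -> 'rV[R]_N).
  by move=> lein; exact: meas_vec_sigma_upto.
have [y [my Sy yc [x_L1 y_L1 xy_L1]]] := iterates_converge P_complete f_cont
  f_convex f_ge0 hC Ss (fun n => gamma_gt0 n.+1) unbounded1 tails1
  (fun n => past n.+1) adapted x_in x1_int (fun n => step n.+1).
exists y; split => //.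
  by apply: filterS yc => w; rewrite (cvg_shiftS (fun n => x n w)).
split=> //; last first.
  by rewrite -(cvg_shiftS
    (fun n => 'N[P]_1%:E[(fun w => (enorm (x n w - y w))%:E)]))%E.
case=> [|n]; last exact: x_L1.
exact: in_L1_of_moment x0_int.
Qed.
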